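(* Let $R$ be a $\delta$-$\mathbb{Z}[q]$-algebra, $A$ a $\delta$-$R$-algebra, $I=pR+[p]_qR$, and $T_1,\dots,T_d\in A$. Let $D_0=A[S_1,\dots,S_d]/([p]_qS_i-T_i)$, $D$ its $\delta$-envelope over $A$, $\tau_i$ the image of $S_i$ in $D$, and $\widehat D=\varprojlim_n D/I^nD$ with the completed $\delta$-structure. Assume there are $t_i\in A$ and $a_i\in R$ with $T_i=t_i-a_i$ and $\delta(t_i)=0$, and that for every $n\in\mathbb{N}$, $D/I^{n+1}D$ is a free $R/I^{n+1}$-module with basis $\prod_{i=1}^d\tau_i^{\{m_i\}_\delta}$, $(m_i)\in\mathbb{N}^d$. Let $\theta_{\widehat D,i}$ be the unique $t_i\mu$-derivation of $\widehat D$ over $R$, $\delta$-compatible with respect to $t_i^{p-1}\eta$, with $\theta_{\widehat D,i}(\tau_i)=1$, $\theta_{\widehat D,i}(\tau_j)=0$ ($j\ne i$). Let $\Omega=\bigoplus_{i}\mathbb{Z}\,dt_i$, $\Omega^k=\wedge^k_\mathbb{Z}\Omega$, and $\theta^k:\widehat D\otimes\Omega^k\to\widehat D\otimes\Omega^{k+1}$, $x\otimes dt_{i_1}\wedge\dots\wedge dt_{i_k}\mapsto\sum_i\theta_{\widehat D,i}(x)\otimes dt_i\wedge dt_{i_1}\wedge\dots\wedge dt_{i_k}$. Then for any ideal $J$ of $R$ containing a power of $I$ and any $R/J$-module $M$, the complex $(M\otimes_R\widehat D\otimes_\mathbb{Z}\Omega^\bullet,\mathrm{id}_M\otimes\theta^\bullet)$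 is a resolution of $M$ (via $M\to M\otimes_R\widehat D$).
   Context: $p$ a fixed prime; $\delta$-ring axioms: $\delta(0)=\delta(1)=0$, $\delta(x+y)=\delta(x)+\delta(y)-\sum_{i=1}^{p-1}\frac1p\binom pi x^iy^{p-i}$, $\delta(xy)=\delta(x)y^p+x^p\delta(y)+p\delta(x)\delta(y)$. $\mathbb{Z}[q]$ has $\delta(q)=0$ (Frobenius $q\mapsto q^p$); $\mu=q-1$, $[p]_q=1+q+\dots+q^{p-1}$, $\eta=\sum_{\nu=1}^{p-1}\frac1p\binom p\nu\mu^{\nu-1}$ (so $\delta(t\mu)=t^{p-1}\eta\cdot t\mu$ if $\delta(t)=0$). The $\delta$-envelope of an $A$-algebra $S$ is the $\delta$-$A$-algebra $S_\delta$ with an $A$-map $S\to S_\delta$ through which every $A$-map into a $\delta$-$A$-algebra factors uniquely by a $\delta$-map. For $m=\sum_{n=0}^Na_np^n$ with $0\le a_n\le p-1$, $\tau^{\{m\}_\delta}=\prod_{n=0}^N\delta^n(\tau)^{a_n}$. An $\alpha$-derivation of a ring over $R$ is an $R$-linear $\partial$ with $\partial(1)=0$, $\partial(xy)=\partial(x)y+x\partial(y)+\alpha\partial(x)\partial(y)$; it is $\delta$-compatible with respect to $\beta$ (where $\delta(\alpha)=\alpha\beta$) if $\partial(\delta x)=(\alpha^{p-1}+p\beta)\delta(\partial x)+\beta(\partial x)^p-\sum_{\nu=1}^{p-1}\frac1p\binom p\nu x^{p-\nu}\alpha^{\nu-1}(\partial x)^\nu$ for all $x$. (The existence, uniqueness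 and commutation of the $\theta_{\widehat D,i}$ are known, so $\theta^{k+1}\circ\theta^k=0$.) *)

(* Defs.v *)
From HB Require Import structures.
From mathcomp Require Import all_boot all_order all_algebra.
Set Implicit Arguments. Unset Strict Implicit. Unset Printing Implicit Defensive.
Import Order.TTheory GRing.Theory Num.Theory.
Local Open Scope ring_scope.

Section Defs.

Variable p : nat.

(* (1/p) binom(p, i), an integer for p prime *)
Definition cbin (S : pzRingType) (i : nat) : S := ('C(p, i) %/ p)%:R.

Definition delta_ring (S : comPzRingType) (delta : S -> S) : Prop :=
  [/\ delta 0 = 0, delta 1 = 0,
      forall x y, delta (x + y) =
        delta x + delta y - \sum_(1 <= i < p) cbin S i * x ^+ i * y ^+ (p - i)
    & forall x y, delta (x * y) =
        delta x * y ^+ p + x ^+ p * delta y + p%:R * delta x * delta y].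

Definition delta_map (S S' : comPzRingType) (dS : S -> S) (dS' : S' -> S')
  (f : S -> S') : Prop := forall x, f (dS x) = dS' (f x).

Definition qnum (S : comPzRingType) (q : S) : S := \sum_(i < p) q ^+ i.
Definition qeta (S : comPzRingType) (q : S) : S :=
  \sum_(1 <= nu < p) cbin S nu * (q - 1) ^+ nu.-1.

(* x belongs to I^n S, where I = (p, [p]_q) and q is the image of q in S:
   I^n S is generated by the p^j [p]_q^(n-j), j <= n. *)
Definition powI (S : comPzRingType) (q : S) (n : nat) (x : S) : Prop :=
  exists y : 'I_n.+1 -> S,
    x = \sum_(j < n.+1) p%:R ^+ j * qnum q ^+ (n - j) * y j.

Definition delta_pow (S : comPzRingType) (delta : S -> S) (tau : S) (m : nat) : S :=
  \prod_(j < m.+1) (iter j delta tau) ^+ ((m %/ p ^ j) %% p).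

(* D (with delta-structure dD, structure map fAD and elements tau) is the
   delta-envelope over A of D_0 = A[S_1..S_d]/(c S_i - T_i), c = [p]_q in A:
   A-algebra maps D_0 -> B are exactly families s with c s_i = T_i. *)
Definition is_delta_envelope (d : nat) (A : comPzRingType) (dA : A -> A)
  (c : A) (T : 'I_d -> A)
  (D : comPzRingType) (dD : D -> D) (fAD : {rmorphism A -> D}) (tau : 'I_d -> D)
  : Prop :=
  [/\ delta_ring dD, delta_map dA dD fAD,
      (forall i, fAD c * tau i = fAD (T i))
    & forall (B : comPzRingType) (dB : B -> B) (g : {rmorphism A -> B})
        (s : 'I_d -> B),
        delta_ring dB -> delta_map dA dB g -> (forall i, g c * s i = g (T i)) ->
        exists h : {rmorphism D -> B},
          [/\ delta_map dD dB h, (forall a, h (fAD a) = g a),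
              (forall i, h (tau i) = s i)
            & forall h' : {rmorphism D -> B},
                delta_map dD dB h' -> (forall a, h' (fAD a) = g a) ->
                (forall i, h' (tau i) = s i) -> forall x, h' x = h x]].

(* Dh (with iota : D -> Dh) is the inverse limit lim_n D/I^n D:
   phi n x is a representative in D of the image of x in D/I^n D, and
   x |-> (phi n x mod I^n D)_n is a ring isomorphism onto the inverse limit,
   compatible with iota. *)
Definition is_Icompletion (D Dh : comPzRingType) (qD : D)
  (iota : {rmorphism D -> Dh}) (phi : nat -> Dh -> D) : Prop :=
  [/\ forall n x y, powI qD n (phi n (x + y) - (phi n x + phi n y)),
      forall n x y, powI qD n (phi n (x * y) - phi n x * phi n y),
      forall n, powI qD n (phi n 1 - 1)
    & forall n x, powI qD n (phi n.+1 x - phi n x)] /\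
  [/\ forall n y, powI qD n (phi n (iota y) - y),
      forall x, (forall n, powI qD n (phi n x)) -> x = 0
    & forall y : nat -> D, (forall n, powI qD n (y n.+1 - y n)) ->
        exists x, forall n, powI qD n (phi n x - y n)].

(* dh is the completed delta-structure: a delta-structure on Dh, extending
   dD through iota and continuous for the inverse-limit topology. *)
Definition completed_delta (D Dh : comPzRingType) (qD : D) (dD : D -> D)
  (iota : {rmorphism D -> Dh}) (phi : nat -> Dh -> D) (dh : Dh -> Dh) : Prop :=
  [/\ delta_ring dh, delta_map dD dh iota
    & forall n, exists m, forall x y, powI qD m (phi m x - phi m y) ->
        powI qD n (phi n (dh x) - phi n (dh y))].

Definition alpha_derivation (R S : comPzRingType) (rho : R -> S) (alpha : S)
  (th : S -> S) : Prop :=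
  [/\ forall x y, th (x + y) = th x + th y,
      forall r x, th (rho r * x) = rho r * th x,
      th 1 = 0
    & forall x y, th (x * y) = th x * y + x * th y + alpha * th x * th y].

Definition delta_compatible (S : comPzRingType) (delta : S -> S) (alpha beta : S)
  (th : S -> S) : Prop :=
  forall x, th (delta x) =
    (alpha ^+ p.-1 + p%:R * beta) * delta (th x) + beta * th x ^+ p
    - \sum_(1 <= nu < p) cbin S nu * x ^+ (p - nu) * alpha ^+ nu.-1 * th x ^+ nu.

Definition balanced (R : comPzRingType) (M : lmodType R) (S : comPzRingType)
  (rho : R -> S) (G : zmodType) (g : M -> S -> G) : Prop :=
  [/\ forall m m' x, g (m + m') x = g m x + g m' x,
      forall m x x', g m (x + x') = g m x + g m x'
    & forall r m x, g (r *: m) x = g m (rho r * x)].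

Definition additive_fun (G H : zmodType) (h : G -> H) : Prop :=
  forall u v, h (u + v) = h u + h v.

Definition is_tensor (R : comPzRingType) (M : lmodType R) (S : comPzRingType)
  (rho : R -> S) (T : zmodType) (b : M -> S -> T) : Prop :=
  balanced rho b /\
  forall (G : zmodType) (g : M -> S -> G), balanced rho g ->
    exists h : T -> G,
      [/\ additive_fun h, (forall m x, h (b m x) = g m x)
        & forall h' : T -> G, additive_fun h' -> (forall m x, h' (b m x) = g m x) ->
            forall u, h' u = h u].

(* T (x)_Z Omega^., Omega^k = wedge^k (+)_i Z dt_i, is modelled by functions on
   subsets of 'I_d: omega S is the coefficient of dt_{i_1} /\ ... /\ dt_{i_k},
   S = {i_1 < ... < i_k}. An element of degree k is supported on k-subsets. *)
Definition of_degree (d : nat) (T : zmodType) (k : nat) (w : {set 'I_d} -> T) : Prop :=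
  forall S : {set 'I_d}, #|S| != k -> w S = 0.

Definition sgn_odd (T : zmodType) (b : bool) (x : T) : T := if b then - x else x.

(* the differential x (x) dt_S |-> sum_i Th_i(x) (x) dt_i /\ dt_S *)
Definition dtheta (d : nat) (T : zmodType) (Th : 'I_d -> T -> T)
  (w : {set 'I_d} -> T) : {set 'I_d} -> T :=
  fun S => \sum_(i in S)
     sgn_odd (odd #|[set j in S | (j < i)%N]|) (Th i (w (S :\ i))).

Definition deg0 (d : nat) (T : zmodType) (y : T) : {set 'I_d} -> T :=
  fun S => if S == set0 then y else 0.

End Defs.

(* Main.v *)
Require Import Defs.
From HB Require Import structures.
From mathcomp Require Import all_boot all_order all_algebra.
From mathcomp Require Import ring zify.
From Stdlib Require Import ClassicalEpsilon.
Import GRing.Theory.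
Local Open Scope ring_scope.

(** Fix [i], write [x_n = delta^n(tau_i)] and let [D_i] be the ring generated over [R] by [t_i]
    and the [x_n]. Modulo [I] one has [t_i = a_i], [mu^(p-1) = 0], and applying [delta] repeatedly
    to [ [p]_q tau_i = t_i - a_i ] expresses [x_n^p] through monomials of degree at most one in
    [x_n]; so [D_i / I D_i] is spanned by the monomials [tau_i^{m}]. Compatibility with [delta]
    gives [theta_i(x_{n+1}) = - x_n^(p-1) theta_i(x_n) + lower terms], hence
    [theta_i(tau_i^{m+1}) = unit * tau_i^{m} + lower terms] modulo [I]. Since [theta_i] is
    [R]-linear and [I] is nilpotent on [M], this can be corrected to a sequence [e_0 = 1],
    [theta_i(e_{m+1}) = e_m] spanning [D_i] modulo [I^N].

    Each [theta_i] kills [D_j] for [j <> i], and [M (x) Dh] is spanned by the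
    [m (x) prod_i y_i], [y_i] in [D_i]. So the operators [Th_i] commute, and the shift
    [e_m |-> e_{m+1}] extends to an additive section of [Th_i] commuting with the other [Th_j];
    these sections yield contracting homotopies of the Koszul complex. An element killed by all
    [Th_i] has only constant coefficients, i.e. comes from [M], and [M -> M (x) Dh] is split by
    the coefficient of the monomial [1]. *)

Set Implicit Arguments.
Unset Strict Implicit.

(** * Powers of the ideal (p, u) and identities for delta *)

Section PropSubring.

Variable S : comPzRingType.

Definition psubring (P : S -> Prop) : Prop :=
  [/\ P 1, forall x y, P x -> P y -> P (x - y)
    & forall x y, P x -> P y -> P (x * y)].

Variable P : S -> Prop.
Hypothesis hP : psubring P.

Lemma psub1 : P 1. Proof. by case: hP. Qed.
Lemma psubB x y : P x -> P y -> P (x - y). Proof. by case: hP => _ h _; apply: h. Qed.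
Lemma psubM x y : P x -> P y -> P (x * y). Proof. by case: hP => _ _; apply. Qed.
Lemma psub0 : P 0. Proof. by rewrite -(subrr 1); apply: psubB; apply: psub1. Qed.
Lemma psubN x : P x -> P (- x).
Proof. by rewrite -(sub0r x); apply: psubB; apply: psub0. Qed.
Lemma psubD x y : P x -> P y -> P (x + y).
Proof. by move=> hx /psubN hy; rewrite -(opprK y); apply: psubB. Qed.
Lemma psubX x n : P x -> P (x ^+ n).
Proof.
by move=> hx; elim: n => [|n IH]; [rewrite expr0; apply: psub1 | rewrite exprS; apply: psubM].
Qed.
Lemma psub_nat n : P n%:R.
Proof.
by elim: n => [|n IH]; [apply: psub0 | rewrite -natr1; apply: psubD => //; apply: psub1].
Qed.
Lemma psub_sum (I : Type) (r : seq I) (Q : pred I) (F : I -> S) :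
  (forall i, Q i -> P (F i)) -> P (\sum_(i <- r | Q i) F i).
Proof. by move=> hF; apply: big_ind => //; [apply: psub0 | apply: psubD]. Qed.

End PropSubring.

Section IdealPowers.

Variables (p : nat) (S : comPzRingType) (u : S).

(* [ipow P n] is [I^n P] for the ideal [I = (p, u)]. *)
Fixpoint ipow (P : S -> Prop) (n : nat) (x : S) : Prop :=
  if n is n'.+1 then
    exists y z, [/\ ipow P n' y, ipow P n' z & x = p%:R * y + u * z]
  else P x.

Lemma ipow_mono (P Q : S -> Prop) n x :
  (forall y, P y -> Q y) -> ipow P n x -> ipow Q n x.
Proof.
move=> hPQ; elim: n x => [|n IH] x /=; first exact: hPQ.
by move=> [y [z [/IH hy /IH hz ->]]]; exists y, z.
Qed.

Variable P : S -> Prop.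
Hypotheses (hP : psubring P) (hu : P u).

Lemma ipow0 n : ipow P n 0.
Proof.
elim: n => [|n IH] /=; first exact: psub0.
by exists 0, 0; split=> //; rewrite !mulr0 addr0.
Qed.

Lemma ipowB n x y : ipow P n x -> ipow P n y -> ipow P n (x - y).
Proof.
elim: n x y => [|n IH] x y /=; first exact: psubB.
move=> [a [b [ha hb ->]]] [c [d [hc hd ->]]].
by exists (a - c), (b - d); split; [exact: IH | exact: IH | ring].
Qed.

Lemma ipowN n x : ipow P n x -> ipow P n (- x).
Proof. by rewrite -(sub0r x); apply/ipowB/ipow0. Qed.

Lemma ipowD n x y : ipow P n x -> ipow P n y -> ipow P n (x + y).
Proof. by move=> hx /ipowN hy; rewrite -(opprK y); apply: ipowB. Qed.

Lemma ipowMl n r x : P r -> ipow P n x -> ipow P n (r * x).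
Proof.
move=> hr; elim: n x => [|n IH] x /=; first exact: psubM.
move=> [a [b [/IH ha /IH hb ->]]].
by exists (r * a), (r * b); split=> //; ring.
Qed.

Lemma ipowMr n r x : P r -> ipow P n x -> ipow P n (x * r).
Proof. by rewrite mulrC; apply: ipowMl. Qed.

Lemma ipow_sum n (I : Type) (r : seq I) (Q : pred I) (F : I -> S) :
  (forall i, Q i -> ipow P n (F i)) -> ipow P n (\sum_(i <- r | Q i) F i).
Proof. by move=> hF; apply: big_ind => //; [apply: ipow0 | apply: ipowD]. Qed.

Lemma ipowS n x : ipow P n.+1 x -> ipow P n x.
Proof.
move=> [y [z [hy hz ->]]]; apply: ipowD; apply: ipowMl => //; exact: psub_nat.
Qed.

Lemma ipow_le m n x : (n <= m)%N -> ipow P m x -> ipow P n x.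
Proof.
move=> /subnKC <-; elim: (m - n)%N => [|k IH]; first by rewrite addn0.
by rewrite addnS => /ipowS /IH.
Qed.

Lemma ipow_sub n x : ipow P n x -> P x.
Proof. exact: (@ipow_le n 0). Qed.

Lemma ipow_pM n x : ipow P n x -> ipow P n.+1 (p%:R * x).
Proof. by move=> hx; exists x, 0; split=> //; [exact: ipow0 | ring]. Qed.

Lemma ipow_uM n x : ipow P n x -> ipow P n.+1 (u * x).
Proof. by move=> hx; exists 0, x; split=> //; [exact: ipow0 | ring]. Qed.

Lemma ipow1p x : P x -> ipow P 1 (p%:R * x). Proof. exact: (@ipow_pM 0). Qed.
Lemma ipow1u x : P x -> ipow P 1 (u * x). Proof. exact: (@ipow_uM 0). Qed.

End IdealPowers.

Lemma psubT (S : comPzRingType) : psubring (fun _ : S => True).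
Proof. by []. Qed.

Lemma ipow_rmorph p (R S : comPzRingType) (f : {rmorphism R -> S}) u
  (P : R -> Prop) (Q : S -> Prop) n x :
  (forall y, P y -> Q (f y)) -> ipow p u P n x -> ipow p (f u) Q n (f x).
Proof.
move=> hPQ; elim: n x => [|n IH] x /=; first exact: hPQ.
move=> [y [z [/IH hy /IH hz ->]]]; exists (f y), (f z); split=> //.
by rewrite rmorphD !rmorphM rmorph_nat.
Qed.

(** Passes from the generators [p^j [p]_q^(n-j)] to a form suited to induction: the top power of [p]
    gives up a factor [p], all other generators contain a factor [u]. *)
Lemma powI_ipow p (S : comPzRingType) (q : S) n x :
  powI p q n x <-> ipow p (qnum p q) (fun=> True) n x.
Proof.
split.
  elim: n x => [|n IH] x //= [y ->]; rewrite big_ord_recr /= subnn mulr1.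
  exists (p%:R ^+ n * y ord_max).
  exists (\sum_(j < n.+1) p%:R ^+ j * qnum p q ^+ (n - j) * y (widen_ord (leqnSn _) j)).
  split.
  - elim: (n) (y ord_max) => [|m IHm] z //=.
    exists (p%:R ^+ m * z), 0; split; [exact: IHm | exact: (ipow0 _ _ (@psubT S)) |].
    by rewrite exprS; ring.
  - by apply: IH; exists (fun j => y (widen_ord (leqnSn _) j)).
  - rewrite addrC mulrA -exprS; congr (_ + _).
    rewrite mulr_sumr; apply: eq_bigr => j _ /=.
    by rewrite subSn ?exprS; [ring | rewrite -ltnS].
elim: n x => [|n IH] x /=.
  by move=> _; exists (fun=> x); rewrite big_ord1 subnn !expr0 !mul1r.
move=> [y [z [/IH [a ->] /IH [b ->] ->]]].
exists (fun j => (if unlift ord0 j is Some k then a k else 0)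
              + (if unlift ord_max j is Some k then b k else 0)).
under [RHS]eq_bigr => j _ do rewrite mulrDr.
rewrite big_split /=; congr (_ + _).
  rewrite [RHS]big_ord_recl unlift_none mulr0 add0r mulr_sumr.
  by apply: eq_bigr => j _; rewrite liftK /= /bump /= add1n subSS exprS; ring.
rewrite [RHS]big_ord_recr /= unlift_none mulr0 addr0 mulr_sumr.
apply: eq_bigr => j _.
have -> : widen_ord (leqnSn n.+1) j = lift ord_max j.
  by apply: val_inj; rewrite /= /bump leqNgt ltn_ord.
by rewrite liftK subSn ?exprS; [ring | rewrite -ltnS].
Qed.

Arguments ipow : simpl never.

(** * Binomial coefficients divided by p, and delta on integers *)

Section Arithmetic.

Variables (p : nat).
Hypothesis hp : prime p.

Let p_gt0 : (0 < p)%N. Proof. exact: prime_gt0. Qed.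
Let p_gt1 : (1 < p)%N. Proof. exact: prime_gt1. Qed.

Lemma cbinK (S : pzRingType) i : (0 < i < p)%N -> p%:R * cbin p S i = 'C(p, i)%:R.
Proof.
by move=> hi; rewrite /cbin -natrM mulnC divnK // prime_dvd_bin.
Qed.

Lemma cbin1 (S : pzRingType) : cbin p S 1 = 1.
Proof. by rewrite /cbin bin1 divnn p_gt0. Qed.

(** Expansion of ((1+mu)^n - 1)/mu; Pascal's rule replaces the division, since [mu] may be a zero
    divisor. *)
Lemma sum_qpow (S : comPzRingType) (mu : S) n :
  \sum_(i < n) (1 + mu) ^+ i = \sum_(v < n) 'C(n, v.+1)%:R * mu ^+ v.
Proof.
elim: n => [|n IH]; first by rewrite !big_ord0.
rewrite big_ord_recr /= IH exprDn.
under [in RHS]eq_bigr => v _ do rewrite binS natrD mulrDl.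
rewrite big_split /= [in RHS]big_ord_recr /= (bin_small (ltnSn n)) mul0r addr0; congr (_ + _).
by apply: eq_bigr => v _; rewrite expr1n mul1r -mulr_natl.
Qed.

(** In [sum_qpow] the top coefficient is 1 and [p] divides the others. This puts [mu^(p-1)] in I and
    later evaluates [alpha^(p-1) + p beta]. *)
Lemma qnum_eta (S : comPzRingType) (q : S) :
  qnum p q = (q - 1) ^+ p.-1 + p%:R * qeta p q.
Proof.
rewrite /qnum /qeta; set mu := q - 1.
have -> : q = 1 + mu by rewrite /mu; ring.
rewrite sum_qpow -(prednK p_gt0) big_ord_recr /= prednK // binn mul1r addrC; congr (_ + _).
rewrite mulr_sumr big_add1 big_mkord; apply: eq_bigr => v _ /=.
by rewrite mulrA cbinK //=; have := ltn_ord v; lia.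
Qed.

Lemma modp_inverse k : (0 < k < p)%N -> exists s l, (k * s = p * l + 1)%N.
Proof.
move=> /andP[k0 kp]; case: (egcdnP p k0) => s l e _; exists s, l.
rewrite mulnC e mulnC; congr (_ + _)%N; apply/eqP.
by rewrite -[_ == _]/(coprime k p) coprime_sym prime_coprime // gtnNdvd.
Qed.

(** Sums [(m+1)^p - m^p - 1] over [m < n]: the double sum is [(n^p - n)/p], which is [-delta(n)]. *)
Lemma sum_cbin_nat n :
  (p * (\sum_(m < n) \sum_(1 <= i < p) 'C(p, i) %/ p * m ^ i) + n = n ^ p)%N.
Proof.
elim: n => [|n IH]; first by rewrite big_ord0 muln0 exp0n.
rewrite big_ord_recr /= mulnDr -[n.+1 in RHS]addn1 addnC expnDn.
under [in RHS]eq_bigr => i _ do rewrite exp1n muln1.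
rewrite big_ord_recl /= bin0 subn0 mul1n -IH.
rewrite -[in RHS](prednK p_gt0) big_ord_recr /= prednK // /bump /=.
rewrite !add1n prednK // binn subnn.
have -> : (\sum_(i < p.-1) 'C(p, 1 + i) * n ^ (p - (1 + i))
   = p * \sum_(1 <= i < p) 'C(p, i) %/ p * n ^ i)%N.
  rewrite big_distrr big_nat_rev big_add1 big_mkord /=; apply: eq_bigr => i _.
  rewrite !add1n !subSS mulnA [(p * _)%N]mulnC divnK.
    by rewrite bin_sub // ltnW //; have := ltn_ord i; lia.
  by apply: prime_dvd_bin => //; have := ltn_ord i; lia.
by rewrite expn0 muln1; lia.
Qed.

Section DeltaRing.

Variables (S : comPzRingType) (dS : S -> S).
Hypothesis hS : delta_ring p dS.

Lemma delta0 : dS 0 = 0. Proof. by case: hS. Qed.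
Lemma delta1 : dS 1 = 0. Proof. by case: hS. Qed.
Lemma deltaD x y : dS (x + y) =
  dS x + dS y - \sum_(1 <= i < p) cbin p S i * x ^+ i * y ^+ (p - i).
Proof. by case: hS. Qed.
Lemma deltaM x y : dS (x * y) =
  dS x * y ^+ p + x ^+ p * dS y + p%:R * dS x * dS y.
Proof. by case: hS. Qed.

Lemma delta_nat n : dS n%:R =
  - (\sum_(m < n) \sum_(1 <= i < p) 'C(p, i) %/ p * m ^ i)%N%:R.
Proof.
elim: n => [|n IH]; first by rewrite big_ord0 delta0 oppr0.
rewrite -natr1 deltaD IH delta1 addr0 big_ord_recr /= natrD opprD; congr (_ - _).
rewrite natr_sum; apply: eq_bigr => i _.
by rewrite expr1n mulr1 natrM natrX.
Qed.

Lemma delta_p : dS p%:R = 1 - p%:R * p%:R ^+ p.-2.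
Proof.
rewrite delta_nat -exprS -natrX; set Z := (\sum_(m < p) _)%N.
(* [p] is cancelled among natural numbers, as it may be a zero divisor in [S]. *)
have : (Z + 1 = p ^ p.-1)%N.
  apply/eqP; rewrite -(eqn_pmul2l p_gt0) -expnS prednK // -(sum_cbin_nat p).
  by rewrite mulnDr muln1.
have -> : p.-2.+1 = p.-1 by lia.
by move=> <-; rewrite natrD; ring.
Qed.

End DeltaRing.

End Arithmetic.

(** * Units of the base ring modulo I *)

Section UnitModI.

Variables (p : nat) (hp : prime p) (R : comPzRingType) (dR : R -> R) (q : R).
Hypotheses (hR : delta_ring p dR) (hq : dR q = 0).

Let u := qnum p q.
Let mu := q - 1.
Local Notation I := (ipow p u (fun=> True) 1).

Let p_gt0 : (0 < p)%N. Proof. exact: prime_gt0. Qed.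
Let p_gt1 : (1 < p)%N. Proof. exact: prime_gt1. Qed.

Definition unit_modI (r : R) : Prop := exists s, ipow p u (fun=> True) 1 (r * s - 1).

Lemma unit_modI1 : unit_modI 1.
Proof. by exists 1; rewrite mulr1 subrr; apply: (ipow0 _ _ (@psubT R)). Qed.

Lemma unit_modI_congr r r' : I (r - r') -> unit_modI r' -> unit_modI r.
Proof.
move=> h [s hs]; exists s.
have -> : r * s - 1 = s * (r - r') + (r' * s - 1) by ring.
by apply: (ipowD (@psubT R)) => //; apply: (ipowMl (@psubT R)).
Qed.

Lemma unit_modI_mul r r' : unit_modI r -> unit_modI r' -> unit_modI (r * r').
Proof.
move=> [s hs] [s' hs']; exists (s * s').
have -> : r * r' * (s * s') - 1 = (r' * s') * (r * s - 1) + (r' * s' - 1) by ring.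
by apply: (ipowD (@psubT R)) => //; apply: (ipowMl (@psubT R)).
Qed.

Lemma unit_modI_opp r : unit_modI r -> unit_modI (- r).
Proof. by move=> [s hs]; exists (- s); rewrite mulrNN. Qed.

Lemma unit_modI_nat k : (0 < k < p)%N -> unit_modI k%:R.
Proof.
move=> /(modp_inverse hp) [s [l e]]; exists s%:R.
rewrite -natrM e natrD natrM addrK.
exact: (ipow1p _ _ (@psubT R)).
Qed.

Lemma mu_pow_I : I (mu ^+ p.-1).
Proof.
have -> : mu ^+ p.-1 = u * 1 - p%:R * qeta p q by rewrite /u (qnum_eta hp); ring.
apply: (ipowB (@psubT R)); first exact: (ipow1u _ _ (@psubT R)).
exact: (ipow1p _ _ (@psubT R)).
Qed.

(** Geometric series in [- (mu * y)], which is nilpotent modulo I by [mu_pow_I]. *)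
Lemma unit_modI_1mu y : unit_modI (1 + mu * y).
Proof.
exists (\sum_(i < p.-1) (- (mu * y)) ^+ i).
have -> : 1 + mu * y = - (- (mu * y) - 1) by ring.
rewrite mulNr -subrX1 opprB addrAC subrr add0r.
have -> : - (mu * y) = mu * (- y) by ring.
rewrite exprMn mulrC; apply: (ipowN (@psubT R)); apply: (ipowMl (@psubT R)) => //.
exact: mu_pow_I.
Qed.

(** The ideal (mu) is stable under delta: as [delta(1 + mu) = delta(q) = 0] and [delta(1) = 0], the
    addition formula writes [delta(mu)] as a sum of multiples of [mu]. *)
Lemma delta_muM x : exists y, dR (mu * x) = mu * y.
Proof.
have [y hy] : exists y, dR mu = mu * y.
  exists (\sum_(1 <= i < p) cbin p R i * mu ^+ (p - i).-1).
  have := deltaD hR 1 mu.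
  rewrite (_ : 1 + mu = q); last by rewrite /mu; ring.
  rewrite hq (delta1 hR) add0r => /esym /subr0_eq ->.
  rewrite mulr_sumr big_nat_cond [RHS]big_nat_cond; apply: eq_bigr => i /andP[/andP[hi hi'] _].
  rewrite expr1n mulr1 -[in LHS](@prednK (p - i)) ?subn_gt0 // exprS; exact: mulrCA.
exists (y * x ^+ p + mu ^+ p.-1 * dR x + p%:R * y * dR x).
rewrite (deltaM hR) hy -[in mu ^+ p](prednK p_gt0) [mu ^+ _]exprS; ring.
Qed.

(** The [n]-th iterate of the Frobenius lift [x^p + p delta(x)], applied to [[p]_q]. *)
Fixpoint frob_q (n : nat) : R :=
  if n is m.+1 then frob_q m ^+ p + p%:R * dR (frob_q m) else u.

Lemma frob_q_I n : I (frob_q n).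
Proof.
elim: n => [|n IH] /=.
  by exists 0, 1; split=> //; ring.
apply: (ipowD (@psubT R)); last exact: (ipow1p _ _ (@psubT R)).
by rewrite -[X in _ ^+ X](prednK p_gt0) exprS; apply: (ipowMr (@psubT R)).
Qed.

Lemma delta_congr_mu y : exists z, dR (p%:R + mu * y) = dR p%:R + mu * z.
Proof.
rewrite (deltaD hR); have [z ->] := delta_muM y.
exists (z - \sum_(1 <= i < p) cbin p R i * p%:R ^+ i * mu ^+ (p - i).-1 * y ^+ (p - i)).
rewrite mulrBr addrA; congr (_ - _).
rewrite mulr_sumr big_nat_cond [RHS]big_nat_cond; apply: eq_bigr => i /andP[/andP[hi hi'] _].
rewrite exprMn -[in LHS](@prednK (p - i)) ?subn_gt0 // exprS [in LHS]prednK ?subn_gt0 //; ring.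
Qed.

(** Modulo [mu], [[p]_q] becomes [p], and the Frobenius lift fixes [p] because
    [p delta(p) = p - p^p]. *)
Lemma frob_q_mu n : exists y, frob_q n = p%:R + mu * y.
Proof.
elim: n => [|n [y IH]] /=.
  exists (\sum_(i < p.-1) 'C(p, i.+2)%:R * mu ^+ i).
  rewrite /u /qnum (_ : q = 1 + mu); last by rewrite /mu; ring.
  rewrite sum_qpow -[in LHS](prednK p_gt0) big_ord_recl /= prednK // bin1 mulr1.
  congr (_ + _); rewrite mulr_sumr; apply: eq_bigr => i _.
  by rewrite /bump /= add1n exprS; ring.
have [z hz] := delta_congr_mu y.
rewrite IH hz (delta_p hp hR).
have /(_ p) [w hw] : forall k, exists w, (p%:R + mu * y) ^+ k = p%:R ^+ k + mu * w.
  elim=> [|k [w hw]]; first by exists 0; rewrite !expr0 mulr0 addr0.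
  by exists (y * p%:R ^+ k + p%:R * w + mu * y * w); rewrite !exprS hw; ring.
exists (w + p%:R * z); rewrite hw.
rewrite -[X in p%:R ^+ X](_ : p.-2.+2 = p); last by lia.
rewrite !exprS; ring.
Qed.

(* [frob_q n = p] modulo [mu], so [delta (frob_q n) = delta p = 1 - p^(p-1)] modulo [mu], which is
   nilpotent modulo [I]. *)
Lemma delta_frob_q_unit n : unit_modI (dR (frob_q n)).
Proof.
have [y ->] := frob_q_mu n; have [z ->] := delta_congr_mu y.
rewrite (delta_p hp hR); apply: (unit_modI_congr (r' := 1 + mu * z)); last exact: unit_modI_1mu.
have -> : 1 - p%:R * p%:R ^+ p.-2 + mu * z - (1 + mu * z) = - (p%:R * p%:R ^+ p.-2) by ring.
apply: (ipowN (@psubT R)); exact: (ipow1p _ _ (@psubT R)).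
Qed.

End UnitModI.

(** * One variable *)

(** The digits of [m] from position [L] on vanish, so they contribute only factors 1. *)
Lemma delta_pow_widen p (hp : prime p) (S : comPzRingType) (dS : S -> S) tau m L :
  (m < p ^ L)%N ->
  delta_pow p dS tau m = \prod_(j < L) (iter j dS tau) ^+ ((m %/ p ^ j) %% p).
Proof.
have main K : forall e, (m < p ^ K)%N ->
    \prod_(j < K + e) (iter j dS tau) ^+ ((m %/ p ^ j) %% p)
    = \prod_(j < K) (iter j dS tau) ^+ ((m %/ p ^ j) %% p).
  elim=> [|e IH] hK; first by rewrite addn0.
  rewrite addnS big_ord_recr /= IH // divn_small ?mod0n ?expr0 ?mulr1 //.
  by apply: leq_trans hK _; rewrite leq_pexp2l ?prime_gt0 // leq_addr.
move=> hL; rewrite /delta_pow.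
have hm : (m < p ^ m.+1)%N by apply: ltnW; apply: ltn_expl; apply: prime_gt1.
case: (leqP L m.+1) => h.
  by rewrite -(subnKC h) main.
by rewrite -(subnKC (ltnW h)) main.
Qed.

Lemma delta_pow_digit p (hp : prime p) (S : comPzRingType) (dS : S -> S) tau a n k :
  (a < p)%N -> (k < p ^ n)%N ->
  delta_pow p dS tau (a * p ^ n + k) = iter n dS tau ^+ a * delta_pow p dS tau k.
Proof.
move=> ha hk; have p0 := prime_gt0 hp.
have hpn : (0 < p ^ n)%N by rewrite expn_gt0 p0.
rewrite (delta_pow_widen hp dS tau (L := n.+1)); last first.
  rewrite expnS; apply: (@leq_trans (a * p ^ n + p ^ n)); first by rewrite ltn_add2l.
  by rewrite -mulSnr leq_mul2r ha orbT.
rewrite (delta_pow_widen hp dS tau hk) big_ord_recr /= mulrC; congr (_ * _).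
  by rewrite divnMDl // (divn_small hk) addn0 modn_small.
apply: eq_bigr => j _; congr (_ ^+ _).
have hj := ltn_ord j.
have -> : (a * p ^ n = (a * p ^ (n - j.+1) * p) * p ^ j)%N.
  by rewrite -!mulnA -expnS -expnD; congr (_ * p ^ _)%N; lia.
by rewrite divnMDl ?expn_gt0 ?p0 // modnMDl.
Qed.

Section OneVariable.

Variables (p : nat) (hp : prime p) (R : comPzRingType) (dR : R -> R) (q : R).
Hypotheses (hR : delta_ring p dR) (hq : dR q = 0).
Variables (S : comPzRingType) (dS : S -> S) (rho : {rmorphism R -> S}).
Hypotheses (hS : delta_ring p dS) (hrho : delta_map dR dS rho).
Variables (t tau : S) (a : R).
Hypotheses (htau : rho (qnum p q) * tau = t - rho a) (ht : dS t = 0).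

Let u := rho (qnum p q).
Let p_gt0 : (0 < p)%N. Proof. exact: prime_gt0. Qed.
Let p_gt1 : (1 < p)%N. Proof. exact: prime_gt1. Qed.
Let pn_gt0 n : (0 < p ^ n)%N. Proof. by rewrite expn_gt0 p_gt0. Qed.

Inductive dgen (n : nat) : S -> Prop :=
| dgen_rho r : dgen n (rho r)
| dgen_t : dgen n t
| dgen_iter j : (j < n)%N -> dgen n (iter j dS tau)
| dgen_add y z : dgen n y -> dgen n z -> dgen n (y + z)
| dgen_mul y z : dgen n y -> dgen n z -> dgen n (y * z).

Lemma dgen_psub n : psubring (dgen n).
Proof.
split.
- by rewrite -(rmorph1 rho); apply: dgen_rho.
- move=> y z hy hz; apply: dgen_add => //.
  by rewrite -mulN1r -(rmorphN1 rho); apply: dgen_mul => //; apply: dgen_rho.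
- exact: dgen_mul.
Qed.

Lemma dgen_le m n y : (m <= n)%N -> dgen m y -> dgen n y.
Proof.
move=> hmn; elim=> *; [exact: dgen_rho | exact: dgen_t | | exact: dgen_add | exact: dgen_mul].
by apply: dgen_iter; apply: leq_trans hmn.
Qed.

(* Modulo [p], [delta] is a derivation relative to Frobenius, hence affine in the new generator. *)
Lemma dgen_delta n y : dgen n y -> exists y0 y1 w,
  [/\ dgen n y0, dgen n y1, dgen n.+1 w
    & dS y = y0 + y1 * iter n dS tau + p%:R * w].
Proof.
have hn := dgen_psub n; have hn1 := dgen_psub n.+1.
have up z : dgen n z -> dgen n.+1 z by apply: dgen_le.
have hx : dgen n.+1 (iter n dS tau) by apply: dgen_iter.
elim=> {y}.
- move=> r; exists (rho (dR r)), 0, 0; split; [exact: dgen_rho | exact: psub0 | exact: psub0 |].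
  by rewrite -hrho; ring.
- by exists 0, 0, 0; split; [exact: psub0 | exact: psub0 | exact: psub0 | rewrite ht; ring].
- move=> j hj; case: (ltnP j.+1 n) => h.
    exists (iter j.+1 dS tau), 0, 0; split; [exact: dgen_iter | exact: psub0 | exact: psub0 |].
    by rewrite /=; ring.
  have -> : n = j.+1 by lia.
  have hj1 := dgen_psub j.+1; have hj2 := dgen_psub j.+2.
  exists 0, 1, 0; split; [exact: psub0 | exact: psub1 | exact: psub0 |].
  by rewrite /=; ring.
- move=> y z hy [y0 [y1 [w [h0 h1 hw e]]]] hz [z0 [z1 [w' [h0' h1' hw' e']]]].
  exists (y0 + z0 - \sum_(1 <= i < p) cbin p S i * y ^+ i * z ^+ (p - i)), (y1 + z1), (w + w').
  split; [|exact: psubD|exact: psubD|rewrite (deltaD hS) e e'; ring].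
  apply: psubB; [by []|exact: psubD|].
  apply: psub_sum => // i _; rewrite /cbin.
  by apply: psubM => //; [apply: psubM => //; [exact: psub_nat|exact: psubX]|exact: psubX].
- move=> y z hy [y0 [y1 [w [h0 h1 hw e]]]] hz [z0 [z1 [w' [h0' h1' hw' e']]]].
  have hyp := psubX hn p hy; have hzp := psubX hn p hz.
  have hdy : dgen n.+1 (dS y).
    rewrite e; apply: psubD => //.
      by apply: psubD; [|exact: up|apply: psubM => //; exact: up].
    by apply: psubM => //; exact: psub_nat.
  have hdz : dgen n.+1 (dS z).
    rewrite e'; apply: psubD => //.
      by apply: psubD; [|exact: up|apply: psubM => //; exact: up].
    by apply: psubM => //; exact: psub_nat.
  exists (y0 * z ^+ p + y ^+ p * z0), (y1 * z ^+ p + y ^+ p * z1),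
    (w * z ^+ p + y ^+ p * w' + dS y * dS z).
  split.
  + by apply: psubD => //; apply: psubM.
  + by apply: psubD => //; apply: psubM.
  + apply: psubD => //; last exact: psubM.
    by apply: psubD => //; apply: psubM => //; exact: up.
  + by rewrite (deltaM hS) -mulrA [in X in _ + X]mulrA e e'; ring.
Qed.

Definition dgens (y : S) : Prop := exists n, dgen n y.

Lemma dgens_psub : psubring dgens.
Proof.
split.
- by exists 0%N; exact: (psub1 (dgen_psub _)).
- move=> y z [m hy] [n hz]; exists (maxn m n); apply: psubB; first exact: dgen_psub.
    by apply: dgen_le hy; apply: leq_maxl.
  by apply: dgen_le hz; apply: leq_maxr.
- move=> y z [m hy] [n hz]; exists (maxn m n); apply: dgen_mul.
    by apply: dgen_le hy; apply: leq_maxl.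
  by apply: dgen_le hz; apply: leq_maxr.
Qed.

Lemma dgens_rho r : dgens (rho r). Proof. by exists 0%N; apply: dgen_rho. Qed.
Lemma dgens_t : dgens t. Proof. by exists 0%N; apply: dgen_t. Qed.
Lemma dgens_iter j : dgens (iter j dS tau). Proof. by exists j.+1; apply: dgen_iter. Qed.

Lemma dgens_delta y : dgens y -> dgens (dS y).
Proof.
move=> [n /dgen_delta [y0 [y1 [w [h0 h1 hw ->]]]]]; have hn := dgen_psub n.+1.
exists n.+1; apply: psubD => //; last by apply: psubM => //; exact: psub_nat.
apply: psubD => //; first exact: dgen_le h0.
by apply: psubM => //; [exact: dgen_le h1 | exact: dgen_iter].
Qed.

Lemma dgens_delta_pow m : dgens (delta_pow p dS tau m).
Proof.
apply: (big_ind dgens); [exact: (psub1 dgens_psub) | exact: (psubM dgens_psub) |].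
by move=> j _; apply: (psubX dgens_psub); exact: dgens_iter.
Qed.

Let hP := dgens_psub.
Let hu : dgens u := dgens_rho _.
Local Notation I n := (ipow p u dgens n).

Lemma ipow_rho n r : ipow p (qnum p q) (fun=> True) n r -> I n (rho r).
Proof. by apply: ipow_rmorph => *; exact: dgens_rho. Qed.

(* Iterating [delta] on [u * tau = t - a] gives [V_n * x_n = w_n] with [V_n = frob_q n] in [I],
   so that applying [delta] once more expresses [x_n ^ p] through smaller monomials modulo [I]. *)
Lemma frob_iter n : exists w, dgen n w /\ rho (frob_q p dR q n) * iter n dS tau = w.
Proof.
elim: n => [|n [w [hw e]]] /=.
  exists (t - rho a); split=> //.
  by apply: psubB; [exact: dgen_psub | exact: dgen_t | exact: dgen_rho].
exists (dS w - rho (dR (frob_q p dR q n)) * iter n dS tau ^+ p); split; last first.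
  by rewrite -e (deltaM hS) -hrho rmorphD rmorphXn rmorphM rmorph_nat; ring.
have [y0 [y1 [v [h0 h1 hv ->]]]] := dgen_delta hw.
have hn := dgen_psub n.+1; apply: psubB => //; last first.
  by apply: psubM => //; [exact: dgen_rho | apply: psubX => //; exact: dgen_iter].
apply: psubD => //; last by apply: psubM => //; exact: psub_nat.
apply: psubD => //; first exact: dgen_le h0.
by apply: psubM => //; [exact: dgen_le h1 | exact: dgen_iter].
Qed.

(** Applying delta to [V * x = w] gives [delta(V) x^p + V' delta(x) = delta(w)] with
    [V' = V^p + p delta(V)] in I. Here [delta(V)] is a unit modulo I, and [delta(w)] is affine in
    [x] modulo [p]. *)
Lemma iter_pow_p n : exists y0 y1, [/\ dgen n y0, dgen n y1
  & I 1 (iter n dS tau ^+ p - (y0 + y1 * iter n dS tau))].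
Proof.
have [w [hw e]] := frob_iter n.
have [s hs] := delta_frob_q_unit hp hR hq n.
have [y0 [y1 [v [h0 h1 hv hd]]]] := dgen_delta hw.
have hn := dgen_psub n.
exists (rho s * y0), (rho s * y1); split.
- by apply: psubM => //; exact: dgen_rho.
- by apply: psubM => //; exact: dgen_rho.
set x := iter n dS tau in e hd *; set V := frob_q p dR q n in e hs *.
have hx : dgens x by exact: dgens_iter.
have E : rho (dR V) * x ^+ p = dS w - rho (frob_q p dR q n.+1) * dS x.
  by rewrite -e (deltaM hS) /= -/V -hrho rmorphD rmorphXn rmorphM rmorph_nat; ring.
have -> : x ^+ p - (rho s * y0 + rho s * y1 * x)
  = rho s * (p%:R * v - rho (frob_q p dR q n.+1) * dS x) - x ^+ p * rho (dR V * s - 1).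
  have -> : p%:R * v = dS w - y0 - y1 * x by rewrite hd; ring.
  have -> : x ^+ p * rho (dR V * s - 1) = rho s * (rho (dR V) * x ^+ p) - x ^+ p.
    by rewrite rmorphB rmorphM rmorph1; ring.
  by rewrite E; ring.
apply: ipowB => //; last by apply: ipowMl => //; [exact: psubX | exact: ipow_rho].
apply: ipowMl => //; first exact: dgens_rho.
apply: ipowB => //; first by apply: ipow1p => //; exists n.+1.
apply: ipowMr => //; [exact: dgens_delta | apply: ipow_rho; exact: frob_q_I].
Qed.

Local Notation tp k := (delta_pow p dS tau k).

(* Linear combinations, modulo [I], of the monomials of index [< m]. The monomials of index
   [< p ^ n] are those in [x_0, .., x_(n-1)], so that [dspan (p ^ n)] is the image of [dgen n]. *)
Definition dspan (m : nat) (y : S) : Prop :=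
  exists r : nat -> R, ipow p u dgens 1 (y - \sum_(k < m) rho (r k) * delta_pow p dS tau k).

Lemma dspanD m y z : dspan m y -> dspan m z -> dspan m (y + z).
Proof.
move=> [r hr] [s hs]; exists (fun k => r k + s k).
under eq_bigr => k _ do rewrite rmorphD mulrDl.
rewrite big_split /= opprD addrACA; exact: ipowD.
Qed.

Lemma dspanMr m r y : dspan m y -> dspan m (rho r * y).
Proof.
move=> [s hs]; exists (fun k => r * s k).
under eq_bigr => k _ do rewrite rmorphM -mulrA.
by rewrite -mulr_sumr -mulrBr; apply: ipowMl => //; exact: dgens_rho.
Qed.

Lemma dspanN m y : dspan m y -> dspan m (- y).
Proof. by rewrite -mulN1r -(rmorphN1 rho); exact: dspanMr. Qed.

Lemma dspanB m y z : dspan m y -> dspan m z -> dspan m (y - z).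
Proof. by move=> hy /dspanN hz; exact: dspanD. Qed.

Lemma dspanI m y : I 1 y -> dspan m y.
Proof.
move=> hy; exists (fun=> 0); rewrite big1 ?subr0 // => i _.
by rewrite rmorph0 mul0r.
Qed.

Lemma dspan_le m n y : (m <= n)%N -> dspan m y -> dspan n y.
Proof.
move=> /subnKC <-; elim: (n - m)%N => [|k IH]; first by rewrite addn0.
move=> /IH [r hr]; rewrite addnS; exists (fun j => if (j < m + k)%N then r j else 0).
rewrite big_ord_recr /= ltnn rmorph0 mul0r addr0.
by under eq_bigr => i _ do rewrite ltn_ord.
Qed.

Lemma dspan_tp k m : (k < m)%N -> dspan m (tp k).
Proof.
move=> hk; apply: (dspan_le hk); exists (fun j => (j == k)%:R).
rewrite big_ord_recr /= eqxx rmorph1 mul1r big1 ?add0r ?subrr; first exact: ipow0.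
by move=> i _; rewrite ltn_eqF // rmorph0 mul0r.
Qed.

Lemma dspan_sum m (J : Type) (r : seq J) (Q : pred J) (G : J -> S) :
  (forall i, Q i -> dspan m (G i)) -> dspan m (\sum_(i <- r | Q i) G i).
Proof.
by move=> hG; apply: big_ind => //; [apply: dspanI; exact: ipow0 | exact: dspanD].
Qed.

Lemma dspan_ind m (Q : S -> Prop) :
  (forall y, I 1 y -> Q y) -> (forall y z, Q y -> Q z -> Q (y + z)) ->
  (forall r k, (k < m)%N -> Q (rho r * tp k)) ->
  forall y, dspan m y -> Q y.
Proof.
move=> hI hD hm y [r hr].
rewrite -(subrK (\sum_(k < m) rho (r k) * tp k) y); apply: (hD); first exact: hI.
apply: (big_ind Q); [by apply: hI; exact: ipow0 | exact: hD |].
by move=> k _; apply: hm.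
Qed.

Lemma dspan_dgens m y : dspan m y -> dgens y.
Proof.
move: y; apply: dspan_ind.
- by move=> y; exact: ipow_sub.
- by move=> y z; exact: psubD.
- by move=> r k _; apply: psubM => //; [exact: dgens_rho | exact: dgens_delta_pow].
Qed.

Lemma dspan0I y : dspan 0 y -> I 1 y.
Proof. by move=> [r]; rewrite big_ord0 subr0. Qed.

Lemma tp0 : tp 0 = 1.
Proof. by rewrite /delta_pow big_ord1 /= divn1 mod0n expr0. Qed.

Lemma dspan_iterX n b m y : (b < p)%N -> (m <= p ^ n)%N -> dspan m y ->
  dspan (b * p ^ n + m) (iter n dS tau ^+ b * y).
Proof.
move=> hb hm; move: y; apply: dspan_ind.
- move=> y hy; apply: dspanI; apply: ipowMl => //; apply: psubX => //; exact: dgens_iter.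
- by move=> y z hy hz; rewrite mulrDr; apply: dspanD.
- move=> r k hk; rewrite mulrCA; apply: dspanMr.
  rewrite -(delta_pow_digit hp) //; last exact: leq_trans hm.
  by apply: dspan_tp; rewrite ltn_add2l.
Qed.

Lemma tp_split n k : exists b k', [/\ k = (b * p ^ n + k')%N, (k' < p ^ n)%N
  & (k < p ^ n.+1)%N -> (b < p)%N].
Proof.
exists (k %/ p ^ n)%N, (k %% p ^ n)%N; split; [exact: divn_eq | exact: ltn_pmod |].
by move=> hk; rewrite ltn_divLR // -expnS.
Qed.

(** * Closure of the monomial spans under products, by induction on the number of digits *)

Section DigitStep.

Variable n : nat.
Hypothesis hn : psubring (dspan (p ^ n)).
Local Notation x := (iter n dS tau).

(** The factor [y] mixes only with the lower digits, by [hn], and leaves the top digit [c < b]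
    alone. *)
Lemma dspan_mul_low b y z : (b <= p)%N ->
  dspan (p ^ n) y -> dspan (b * p ^ n) z -> dspan (b * p ^ n) (y * z).
Proof.
move=> hb hy; move: z; apply: dspan_ind.
- by move=> z hz; apply: dspanI; apply: ipowMl => //; exact: dspan_dgens hy.
- by move=> z z' h h'; rewrite mulrDr; exact: dspanD.
move=> r k hk; rewrite mulrCA; apply: dspanMr.
have [c [k' [e hk' _]]] := tp_split n k.
have hc : (c < b)%N.
  by rewrite -(ltn_pmul2r (pn_gt0 n)); apply: leq_ltn_trans hk; rewrite e leq_addr.
rewrite e delta_pow_digit //; last exact: leq_trans hb.
rewrite mulrCA; apply: (@dspan_le (c * p ^ n + p ^ n)); first by rewrite -mulSnr leq_mul2r hc orbT.
apply: dspan_iterX => //; first exact: leq_trans hb.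
by apply: psubM => //; exact: dspan_tp.
Qed.

(** The bound on [m] keeps the top digit below [p - 1], so the factor [x] raises it without a
    carry. *)
Lemma dspan_mul_iter m z : (m <= p.-1 * p ^ n)%N ->
  dspan m z -> dspan (m + p ^ n) (x * z).
Proof.
move=> hm; move: z; apply: dspan_ind.
- by move=> z hz; apply: dspanI; apply: ipowMl => //; exact: dgens_iter.
- by move=> z z' h h'; rewrite mulrDr; exact: dspanD.
move=> r k hk; rewrite mulrCA; apply: dspanMr.
have [c [k' [e hk' _]]] := tp_split n k.
have hc : (c < p.-1)%N.
  rewrite -(ltn_pmul2r (pn_gt0 n)); apply: leq_trans hm.
  by apply: leq_ltn_trans hk; rewrite e leq_addr.
have hc' : (c.+1 < p)%N by lia.
rewrite e delta_pow_digit //; last exact: ltnW.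
rewrite mulrA -exprS -delta_pow_digit //; apply: dspan_tp.
by move: hk; rewrite e mulSn; lia.
Qed.

Lemma dgen_dspan y : dgen n y -> dspan (p ^ n) y.
Proof.
elim=> {y}.
- by move=> r; rewrite -[rho r]mulr1; apply: dspanMr; exact: psub1.
- have -> : t = u * tau + rho a * 1 by rewrite htau; ring.
  apply: dspanD; last by apply: dspanMr; exact: psub1.
  by apply: dspanI; apply: ipow1u => //; exact: (dgens_iter 0).
- move=> j hj; rewrite -[iter _ _ _]mulr1 -tp0 -[iter _ _ _]expr1 -delta_pow_digit //.
  by apply: dspan_tp; rewrite addn0 mul1n ltn_exp2l.
- by move=> y z _ hy _ hz; exact: dspanD.
- by move=> y z _ hy _ hz; exact: psubM.
Qed.

(** A carry arises only when [x] meets a top digit [p - 1]; then [iter_pow_p] replaces [x^p] by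
    [y0 + y1 x], where the degrees 0 and 1 in [x] are admissible as [p >= 2]. General products
    follow by iterating [x]. *)
Lemma dspan_psub_step : psubring (dspan (p ^ n.+1)).
Proof.
have hpS : (p ^ n.+1 = p * p ^ n)%N by rewrite expnS.
have hx z : dspan (p ^ n.+1) z -> dspan (p ^ n.+1) (x * z).
  move: z; apply: dspan_ind.
  - by move=> z hz; apply: dspanI; apply: ipowMl => //; exact: dgens_iter.
  - by move=> z z' h h'; rewrite mulrDr; exact: dspanD.
  move=> r k hk; rewrite mulrCA; apply: dspanMr.
  have [c [k' [e hk' /(_ hk) hc]]] := tp_split n k.
  rewrite e delta_pow_digit // mulrA -exprS.
  case: (ltnP c.+1 p) => hc'.
    apply: (@dspan_le (c.+1 * p ^ n + p ^ n)); first by rewrite hpS -mulSnr leq_mul2r hc' orbT.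
    by apply: dspan_iterX => //; exact: dspan_tp.
  have -> : c.+1 = p by lia.
  have [y0 [y1 [h0 h1 hI]]] := iter_pow_p n.
  have -> : x ^+ p * tp k'
    = (x ^+ p - (y0 + y1 * x)) * tp k' + (y0 * tp k' + x * (y1 * tp k')) by ring.
  apply: dspanD; first by apply: dspanI; apply: ipowMr => //; exact: dgens_delta_pow.
  have hlow y : dgen n y -> dspan (p ^ n) (y * tp k').
    by move=> hy; apply: psubM => //; [exact: dgen_dspan | exact: dspan_tp].
  apply: dspanD.
    by apply: (@dspan_le (p ^ n)); [rewrite hpS leq_pmull | exact: hlow].
  apply: (@dspan_le (p ^ n + p ^ n)); first by rewrite hpS addnn -mul2n leq_mul2r p_gt1 orbT.
  by apply: dspan_mul_iter; [rewrite leq_pmull //; lia | exact: hlow].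
split; [|exact: dspanB|].
  by rewrite -tp0; exact: dspan_tp.
move=> y z hy hz; move: y hy; apply: dspan_ind.
- by move=> y hy; apply: dspanI; apply: ipowMr => //; exact: dspan_dgens hz.
- by move=> y y' h h'; rewrite mulrDl; exact: dspanD.
move=> r k hk; rewrite -mulrA; apply: dspanMr.
have [c [k' [e hk' /(_ hk) hc]]] := tp_split n k.
rewrite e delta_pow_digit // -mulrA.
have : dspan (p ^ n.+1) (tp k' * z).
  by rewrite hpS; apply: dspan_mul_low; rewrite -?hpS //; exact: dspan_tp.
elim: (c) => [|m IH] h; first by rewrite expr0 mul1r.
by rewrite exprS -mulrA; apply: hx; exact: IH.
Qed.

End DigitStep.

Lemma dspan_psub n : psubring (dspan (p ^ n)).
Proof.
elim: n => [|n IH]; last exact: dspan_psub_step.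
split; [by rewrite -tp0; exact: dspan_tp | exact: dspanB |].
move=> y z hy hz; move: y hy; apply: dspan_ind.
- by move=> y hy; apply: dspanI; apply: ipowMr => //; exact: dspan_dgens hz.
- by move=> y y' h h'; rewrite mulrDl; exact: dspanD.
- by move=> r k; rewrite expn0 ltnS leqn0 => /eqP ->; rewrite tp0 mulr1; exact: dspanMr.
Qed.

Lemma dgens_dspan y : dgens y -> exists n, dspan (p ^ n) y.
Proof. by move=> [n hn]; exists n; apply: dgen_dspan => //; exact: dspan_psub. Qed.

(** Every term of the compatibility formula for [th (dS x)] vanishes with [th x]. Here [alpha] and
    [beta] are arbitrary because in the application they belong to another index than [t] and
    [tau]. *)
Lemma dgens_ann (alpha beta : S) (th : S -> S) :
  alpha_derivation rho alpha th -> delta_compatible p dS alpha beta th ->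
  th tau = 0 -> forall y, dgens y -> th y = 0.
Proof.
move=> [thD thr th1 thM] hc htt y [n]; elim=> {y}.
- by move=> r; rewrite -[rho r]mulr1 thr th1 mulr0.
- have -> : t = u * tau + rho a * 1 by rewrite htau; ring.
  by rewrite thD !thr th1 htt !mulr0 addr0.
- move=> j _; elim: j => [|j IH] //=; rewrite hc IH (delta0 hS) !mulr0 expr0n.
  rewrite gtn_eqF //= mulr0 addr0 add0r big_nat_cond big1 ?oppr0 // => i /andP[/andP[hi _] _].
  by rewrite expr0n gtn_eqF // mulr0.
- by move=> y z _ hy _ hz; rewrite thD hy hz addr0.
- by move=> y z _ hy _ hz; rewrite thM hy hz; ring.
Qed.

Variable theta : S -> S.
Let alpha := t * rho (q - 1).
Let beta := t ^+ p.-1 * rho (qeta p q).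
Hypothesis hder : alpha_derivation rho alpha theta.
Hypothesis hcomp : delta_compatible p dS alpha beta theta.
Hypothesis htheta : theta tau = 1.

Let thD y z : theta (y + z) = theta y + theta z. Proof. by case: hder. Qed.
Let thr r y : theta (rho r * y) = rho r * theta y. Proof. by case: hder. Qed.
Let th1 : theta 1 = 0. Proof. by case: hder. Qed.
Let thM y z : theta (y * z) = theta y * z + y * theta z + alpha * theta y * theta z.
Proof. by case: hder. Qed.
Let thrho r : theta (rho r) = 0. Proof. by rewrite -[rho r]mulr1 thr th1 mulr0. Qed.
Let th0 : theta 0 = 0. Proof. by rewrite -{1}(rmorph0 rho) thrho. Qed.
Let thB y z : theta (y - z) = theta y - theta z.
Proof. by rewrite thD -[- z]mulN1r -(rmorphN1 rho) thr rmorphN1 mulN1r. Qed.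
Let thp y : theta (p%:R * y) = p%:R * theta y.
Proof. by rewrite -(rmorph_nat rho) thr. Qed.

Let alpha_dgens : dgens alpha.
Proof. by apply: psubM => //; [exact: dgens_t | exact: dgens_rho]. Qed.
Let beta_dgens : dgens beta.
Proof. by apply: psubM => //; [apply: psubX => //; exact: dgens_t | exact: dgens_rho]. Qed.

Lemma alpha_beta : alpha ^+ p.-1 + p%:R * beta = t ^+ p.-1 * u.
Proof.
rewrite /u (qnum_eta hp) rmorphD rmorphXn rmorphM rmorph_nat /alpha /beta exprMn; ring.
Qed.

Lemma theta_delta y : theta (dS y) = t ^+ p.-1 * u * dS (theta y) + beta * theta y ^+ p
  - (y ^+ p.-1 * theta y
     + \sum_(2 <= v < p) cbin p S v * y ^+ (p - v) * alpha ^+ v.-1 * theta y ^+ v).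
Proof.
rewrite hcomp alpha_beta; congr (_ - _).
by rewrite big_ltn // cbin1 // expr0 expr1 mul1r mulr1 subn1.
Qed.

Lemma dgens_theta y : dgens y -> dgens (theta y).
Proof.
move=> [n]; elim=> {y}.
- by move=> r; rewrite thrho; exact: psub0.
- have -> : t = u * tau + rho a * 1 by rewrite htau; ring.
  rewrite thD !thr th1 htheta mulr0 addr0 mulr1; exact: dgens_rho.
- move=> j _; elim: j => [|j IH] /=; first by rewrite htheta; exact: psub1.
  rewrite hcomp alpha_beta; apply: psubB => //.
    apply: psubD => //; apply: psubM => //; [|exact: dgens_delta|exact: psubX].
    by apply: psubM => //; apply: psubX => //; exact: dgens_t.
  apply: psub_sum => // v _; rewrite /cbin.
  apply: psubM => //; last exact: psubX.
  apply: psubM => //; last exact: psubX.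
  by apply: psubM => //; [exact: psub_nat | apply: psubX => //; exact: dgens_iter].
- by move=> y z _ hy _ hz; rewrite thD; exact: psubD.
- move=> y z hy hty hz htz; have hy' : dgens y by exists n. have hz' : dgens z by exists n.
  rewrite thM; apply: psubD => //; last by apply: psubM => //; exact: psubM.
  by apply: psubD => //; exact: psubM.
Qed.

Definition dlead (m : nat) (y : S) : Prop :=
  exists v, unit_modI p q v /\ dspan m (y - rho v * delta_pow p dS tau m).

Lemma dlead_dspan m y : dlead m y -> dspan m.+1 y.
Proof.
move=> [v [_ h]]; rewrite -(subrK (rho v * tp m) y).
by apply: dspanD; [exact: dspan_le h | apply: dspanMr; exact: dspan_tp].
Qed.

Lemma dlead_add m y z : dspan m z -> dlead m y -> dlead m (y + z).
Proof. by move=> hz [v [hv h]]; exists v; split=> //; rewrite addrAC; exact: dspanD. Qed.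

Lemma alpha_dspan n : dspan (p ^ n) alpha.
Proof.
apply: psubM; first exact: dspan_psub; apply: dgen_dspan; rewrite ?/dgen_t.
all: first [exact: dspan_psub | exact: dgen_t | exact: dgen_rho].
Qed.

Lemma beta_dspan n : dspan (p ^ n) beta.
Proof.
apply: psubM; [exact: dspan_psub | apply: psubX; first exact: dspan_psub |].
all: apply: dgen_dspan; first [exact: dspan_psub | exact: dgen_t | exact: dgen_rho].
Qed.

(** All [n] digits of the index [p^n - 1] equal [p - 1]. In [theta_delta] the term with [u] lies in
    I, [beta theta(x)^p] involves lower generators only, and the terms with [v >= 2] have degree at
    most [p - 2] in [x]; what remains is [- x^(p-1) theta(x)]. *)
Lemma theta_iter_lead n : dlead (p ^ n).-1 (theta (iter n dS tau)).
Proof.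
elim: n => [|n IH].
  exists 1; split; first exact: unit_modI1.
  by rewrite /= htheta tp0 rmorph1 mulr1 subrr; apply: dspanI; exact: ipow0.
have hn := dspan_psub n.
have hspan : dspan (p ^ n) (theta (iter n dS tau)).
  by have := dlead_dspan IH; rewrite prednK.
case: IH => v [hv h].
exists (- v); split; first exact: unit_modI_opp.
rewrite [iter n.+1 dS tau]/= theta_delta.
set x := iter n dS tau in h hspan *.
have hx : dgens x by exact: dgens_iter.
have e : ((p ^ n.+1).-1 = p.-1 * p ^ n + (p ^ n).-1)%N.
  by have := pn_gt0 n; rewrite expnS; have := mulSn p.-1 (p ^ n); rewrite prednK //; lia.
rewrite {2}e delta_pow_digit ?ltn_predL //.
rewrite rmorphN mulNr opprK -/x.
set T := tp _ in h *; set Z := \sum_(2 <= _ < p) _.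
have -> : t ^+ p.-1 * u * dS (theta x) + beta * theta x ^+ p - (x ^+ p.-1 * theta x + Z)
   + rho v * (x ^+ p.-1 * T)
  = u * (t ^+ p.-1 * dS (theta x)) + beta * theta x ^+ p
    - (x ^+ p.-1 * (theta x - rho v * T) + Z) by ring.
have hle : (p ^ n <= (p ^ n.+1).-1)%N.
  rewrite e; apply: (leq_trans (leq_pmull _ _)); [|exact: leq_addr]; lia.
apply: dspanB; last apply: dspanD.
- apply: dspanD.
    apply: dspanI; apply: ipow1u => //; apply: psubM => //.
      by apply: psubX => //; exact: dgens_t.
    by apply: dgens_delta; exact: dspan_dgens hspan.
  apply: (dspan_le hle); apply: psubM => //; [exact: beta_dspan | exact: psubX].
- by rewrite e; apply: dspan_iterX => //; [lia | exact: leq_pred].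
- rewrite /Z big_nat_cond; apply: dspan_sum => v' /andP[/andP[h2 hp'] _].
  have -> : cbin p S v' * x ^+ (p - v') * alpha ^+ v'.-1 * theta x ^+ v'
     = x ^+ (p - v') * (cbin p S v' * alpha ^+ v'.-1 * theta x ^+ v') by ring.
  apply: (@dspan_le ((p - v') * p ^ n + p ^ n)).
    rewrite e -mulSnr; apply: (@leq_trans (p.-1 * p ^ n)); last exact: leq_addr.
    by rewrite leq_mul2r; lia.
  apply: dspan_iterX => //; first lia.
  apply: psubM => //; last exact: psubX.
  by apply: psubM => //; [exact: psub_nat | apply: psubX => //; exact: alpha_dspan].
Qed.

(** The leading part of [theta(x^b)] is [b x^(b-1) theta(x)], with [b] a unit modulo I; the twisted
    term [alpha theta(x) theta(x^(b-1))] only has indices below [(b-1) p^n]. *)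
Lemma theta_iterX_lead n b : (0 < b < p)%N ->
  dlead (b * p ^ n).-1 (theta (iter n dS tau ^+ b)).
Proof.
have hn := dspan_psub n; have pn0 := pn_gt0 n.
have [v [hv h]] := theta_iter_lead n.
have hspan : dspan (p ^ n) (theta (iter n dS tau)).
  by have := dlead_dspan (theta_iter_lead n); rewrite prednK.
set x := iter n dS tau in h hspan *; set T := tp _ in h.
have tpE b' : (b' < p)%N -> tp (b'.+1 * p ^ n).-1 = x ^+ b' * T.
  move=> hb; rewrite -delta_pow_digit // ?prednK //; congr (delta_pow _ _ _ _).
  by rewrite mulSnr; lia.
suff main b' : (b'.+1 < p)%N -> dspan (b'.+1 * p ^ n).-1
    (theta (x ^+ b'.+1) - rho (b'.+1%:R * v) * (x ^+ b' * T)).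
  case: b => // b' hb; exists (b'.+1%:R * v); split.
    by apply: unit_modI_mul => //; exact: unit_modI_nat.
  by rewrite tpE; [exact: main | exact: ltnW].
elim: b' => [|b' IH] hb; first by rewrite mul1n expr1 expr0 !mul1r.
have {}IH := IH (ltnW hb).
have hX : dspan (b'.+1 * p ^ n) (theta (x ^+ b'.+1)).
  rewrite -(subrK (rho (b'.+1%:R * v) * (x ^+ b' * T)) (theta _)); apply: dspanD.
    by apply: dspan_le IH; exact: leq_pred.
  apply: dspanMr; rewrite -tpE; last exact/ltnW/ltnW.
  by apply: dspan_tp; rewrite prednK // muln_gt0 pn0.
have -> : theta (x ^+ b'.+2) - rho (b'.+2%:R * v) * (x ^+ b'.+1 * T)
  = x ^+ b'.+1 * (theta x - rho v * T)
    + x * (theta (x ^+ b'.+1) - rho (b'.+1%:R * v) * (x ^+ b' * T))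
    + alpha * theta x * theta (x ^+ b'.+1).
  rewrite [x ^+ b'.+2]exprS thM -[b'.+2%:R]natr1 !rmorphM rmorphD rmorph1.
  by move: (theta (x ^+ b'.+1)) => Y; rewrite !exprS; ring.
apply: dspanD; first apply: dspanD.
- apply: (@dspan_le (b'.+1 * p ^ n + (p ^ n).-1)); first by rewrite [(b'.+2 * _)%N]mulSnr; lia.
  by apply: dspan_iterX => //; [exact: ltnW | exact: leq_pred].
- apply: (@dspan_le ((b'.+1 * p ^ n).-1 + p ^ n)); first by rewrite !mulSnr; lia.
  apply: dspan_mul_iter => //; apply: (leq_trans (leq_pred _)).
  by rewrite leq_mul2r; apply/orP; right; lia.
- apply: (@dspan_le (b'.+1 * p ^ n)); first by rewrite [(b'.+2 * _)%N]mulSnr; lia.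
  apply: dspan_mul_low => //; first lia.
  by apply: psubM => //; exact: alpha_dspan.
Qed.

(** Write [m+1 = b p^n + m'] with leading digit [b]. If [m'] is nonzero, the leading term comes from
    [x^b theta(tp m')], known by strong induction; otherwise from [theta(x^b)]. *)
Lemma theta_tp_lead m : dlead m (theta (tp m.+1)).
Proof.
have [k hk] := ubnP m; elim: k => // k IHk in m hk *.
have [h1 h2] := andP (trunc_log_bounds p_gt1 (ltn0Sn m)).
set n := trunc_log p m.+1 in h1 h2.
have hn := dspan_psub n; have pn0 := pn_gt0 n.
have [b [m' [e hm' /(_ h2) hb]]] := tp_split n m.+1.
have hb0 : (0 < b)%N by case: (b) e => // e; move: h1; rewrite e mul0n add0n leqNgt hm'.
rewrite e delta_pow_digit //.
have hlead := @theta_iterX_lead n b; rewrite hb0 hb in hlead; move/(_ isT): hlead => hlead.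
case: m' => [|m'] in e hm' *.
  by rewrite tp0 mulr1; move: hlead; rewrite -[(b * p ^ n)%N]addn0 -e.
have {}e : (m = b * p ^ n + m')%N by lia.
have hX : dspan (b * p ^ n) (theta (iter n dS tau ^+ b)).
  by have := dlead_dspan hlead; rewrite prednK // muln_gt0 hb0.
have [|v [hv h]] := IHk m'.
  by move: pn0 hk hb0; rewrite e; case: (b) => // b'; rewrite mulSn; lia.
have hspan : dspan (p ^ n) (theta (tp m'.+1)).
  by apply: (dspan_le (ltnW hm')); apply: dlead_dspan; exists v.
exists v; split=> //; rewrite thM {2}e delta_pow_digit //; last exact: ltnW.
set x := iter n dS tau in hX *.
have -> : theta (x ^+ b) * tp m'.+1 + x ^+ b * theta (tp m'.+1)
   + alpha * theta (x ^+ b) * theta (tp m'.+1) - rho v * (x ^+ b * tp m')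
  = tp m'.+1 * theta (x ^+ b) + x ^+ b * (theta (tp m'.+1) - rho v * tp m')
    + alpha * theta (tp m'.+1) * theta (x ^+ b) by ring.
have low z : dspan (p ^ n) z -> dspan m (z * theta (x ^+ b)).
  move=> hz; apply: (@dspan_le (b * p ^ n)); first by rewrite e leq_addr.
  by apply: dspan_mul_low => //; exact: ltnW.
apply: dspanD; first apply: dspanD.
- by apply: low; exact: dspan_tp.
- by rewrite e; apply: dspan_iterX => //; exact/ltnW/ltnW.
- by apply: low; apply: psubM => //; exact: alpha_dspan.
Qed.

Lemma dspanS m y : dspan m.+1 y -> exists r, dspan m (y - rho r * tp m).
Proof.
move=> [r hr]; exists (r m), r; move: hr; rewrite big_ord_recr /=.
by rewrite opprD addrA addrAC.
Qed.

Lemma unit_tp r s m : ipow p (qnum p q) (fun=> True) 1 (r * s - 1) ->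
  I 1 (rho r * (rho s * tp m) - tp m).
Proof.
move=> /ipow_rho h; have -> : rho r * (rho s * tp m) - tp m = rho (r * s - 1) * tp m.
  by rewrite rmorphB rmorphM rmorph1; ring.
by apply: ipowMr => //; exact: dgens_delta_pow.
Qed.

(** Triangular elimination: the leading term [r tp_m] of [y] is cancelled by the image of
    [r s tp_(m+1)], where [s] inverts the leading coefficient [v] modulo I. *)
Lemma theta_surj_span m y : dspan m y ->
  exists z, dspan m.+1 z /\ I 1 (theta z - y).
Proof.
elim: m y => [|m IH] y hy.
  exists 0; split; first by apply: dspanI; exact: ipow0.
  by rewrite th0 sub0r; apply: ipowN => //; exact: dspan0I.
have [r hr] := dspanS hy.
have [v [[s hs] hv]] := theta_tp_lead m.
have [|z [hz hI]] := IH (y - theta (rho (r * s) * tp m.+1)); last first.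
  exists (rho (r * s) * tp m.+1 + z); split.
    by apply: dspanD; [apply: dspanMr; exact: dspan_tp | exact: dspan_le hz].
  by rewrite thD; move: hI; congr (ipow _ _ _ _ _); ring.
rewrite thr rmorphM.
have -> : y - rho r * rho s * theta (tp m.+1) = y - rho r * tp m
   - (rho r * rho s * (theta (tp m.+1) - rho v * tp m)
      + rho r * (rho v * (rho s * tp m) - tp m)) by ring.
apply: dspanB => //; apply: dspanD; first by rewrite -rmorphM; exact: dspanMr.
by apply: dspanMr; apply: dspanI; exact: unit_tp.
Qed.

(** Successive approximation: an error in I is [p y1 + u y2] with [y1], [y2] again in the ring, and
    [theta] commutes with [p] and [u], so each round gains a power of I. *)
Lemma theta_surj N y : dgens y -> exists z, dgens z /\ I N (theta z - y).
Proof.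
elim: N y => [|N IH] y hy.
  by exists 0; split; [exact: psub0 | apply: psubB => //; rewrite th0; exact: psub0].
have [n hn] := dgens_dspan hy.
have [z0 [/dspan_dgens hz0 [y1 [y2 [h1 h2 e]]]]] := theta_surj_span hn.
have [z1 [hz1 e1]] := IH _ h1; have [z2 [hz2 e2]] := IH _ h2.
exists (z0 - (p%:R * z1 + u * z2)); split.
  by apply: psubB => //; apply: psubD => //; apply: psubM => //; exact: psub_nat.
exists (y1 - theta z1), (y2 - theta z2).
split; [by rewrite -opprB; exact: ipowN | by rewrite -opprB; exact: ipowN |].
by rewrite thB thD thr thp addrAC e; ring.
Qed.

(** The elimination starts with a unit multiple of the next monomial, and all corrections beyond the
    first order lie in I, so the leading term survives. *)
Lemma theta_surj_lead N m y : dlead m y -> exists z, dlead m.+1 z /\ I N.+1 (theta z - y).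
Proof.
move=> [w [hw hy]].
have [v [[s hs] hv]] := theta_tp_lead m.
have hsu : unit_modI p q s by exists v; rewrite mulrC.
have [z [hz [y1 [y2 [h1 h2 e]]]]] : exists z, dlead m.+1 z /\ I 1 (theta z - y).
  have [|z [hz hI]] := @theta_surj_span m (y - theta (rho (w * s) * tp m.+1)); last first.
    exists (rho (w * s) * tp m.+1 + z); split.
      exists (w * s); split; first exact: unit_modI_mul.
      by rewrite addrAC subrr add0r.
    by rewrite thD; move: hI; congr (ipow _ _ _ _ _); ring.
  rewrite thr rmorphM.
  have -> : y - rho w * rho s * theta (tp m.+1) = y - rho w * tp m
     - (rho w * rho s * (theta (tp m.+1) - rho v * tp m)
        + rho w * (rho v * (rho s * tp m) - tp m)) by ring.
  apply: dspanB => //; apply: dspanD; first by rewrite -rmorphM; exact: dspanMr.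
  by apply: dspanMr; apply: dspanI; exact: unit_tp.
have [z1 [hz1 e1]] := theta_surj N h1; have [z2 [hz2 e2]] := theta_surj N h2.
exists (z - (p%:R * z1 + u * z2)); split.
  apply: dlead_add hz; apply: dspanN; apply: dspanI.
  by exists z1, z2.
exists (y1 - theta z1), (y2 - theta z2).
split; [by rewrite -opprB; exact: ipowN | by rewrite -opprB; exact: ipowN |].
by rewrite thB thD thr thp addrAC e; ring.
Qed.

Inductive lspan (e : nat -> S) : S -> Prop :=
| lspan0 : lspan e 0
| lspanD r k y : lspan e y -> lspan e (rho r * e k + y).

Lemma lspan_comb e r y z : lspan e y -> lspan e z -> lspan e (rho r * y + z).
Proof.
move=> hy hz; elim: hy => [|r' k y' _ IH]; first by rewrite mulr0 add0r.
by rewrite mulrDr -addrA mulrA -rmorphM; apply: lspanD.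
Qed.

(** The [e m] are triangular over the monomials with unit leading coefficients: eliminate modulo I,
    then approximate up to [I^N]. *)
Lemma lspan_dgens (e : nat -> S) N y : (forall m, dlead m (e m)) -> dgens y ->
  exists z, lspan e z /\ I N (y - z).
Proof.
move=> hl.
have low m : forall y, dspan m y -> exists z, lspan e z /\ I 1 (y - z).
  elim: m => [|m IH] {}y hy.
    by exists 0; split; [exact: lspan0 | rewrite subr0; exact: dspan0I].
  have [r hr] := dspanS hy; have [v [[s hs] hv]] := hl m.
  have [|z [hz hI]] := IH (y - rho (r * s) * e m).
    have -> : y - rho (r * s) * e m = y - rho r * tp m
       - (rho (r * s) * (e m - rho v * tp m) + rho r * (rho v * (rho s * tp m) - tp m)).
      by rewrite rmorphM; ring.
    apply: dspanB => //; apply: dspanD; first exact: dspanMr.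
    by apply: dspanMr; apply: dspanI; exact: unit_tp.
  exists (rho (r * s) * e m + z); split; first exact: lspanD.
  by rewrite opprD addrA.
elim: N y => [|N IH] y hy.
  by exists 0; split; [exact: lspan0 | rewrite subr0].
have [n /low [z [hz [y1 [y2 [h1 h2 ez]]]]]] := dgens_dspan hy.
have [z1 [hz1 e1]] := IH _ h1; have [z2 [hz2 e2]] := IH _ h2.
exists (p%:R * z1 + (u * z2 + z)); split.
  by rewrite -(rmorph_nat rho); do 2 apply: lspan_comb => //.
exists (y1 - z1), (y2 - z2); split=> //.
have -> : y - (p%:R * z1 + (u * z2 + z)) = (y - z) - (p%:R * z1 + u * z2) by ring.
by rewrite ez; ring.
Qed.

Theorem theta_basis N : exists e : nat -> S,
  [/\ e 0%N = 1, forall m, dgens (e m), forall m, I N (theta (e m.+1) - e m)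
    & forall y, dgens y -> exists z, lspan e z /\ I N (y - z)].
Proof.
(* The specification of this choice applies only when [dlead m y] holds, which [hl] maintains along
   the sequence starting at 1. *)
pose nxt m y := epsilon (inhabits 0) (fun z => dlead m.+1 z /\ I N.+1 (theta z - y)).
pose e := fix e m := if m is m'.+1 then nxt m' (e m') else 1.
have hl m : dlead m (e m).
  elim: m => [|m IH]; last exact: (proj1 (epsilon_spec _ _ (theta_surj_lead N IH))).
  exists 1; split; first exact: unit_modI1.
  by rewrite tp0 rmorph1 mulr1 subrr; apply: dspanI; exact: ipow0.
exists e; split=> // [m|m|y hy].
- by apply: dspan_dgens; exact: dlead_dspan (hl m).
- by apply: ipowS => //; exact: (proj2 (epsilon_spec _ _ (theta_surj_lead N (hl m)))).
- exact: lspan_dgens.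
Qed.

End OneVariable.

(** * Koszul complexes of operators with commuting sections *)

Section AdditiveFun.

Variables (G H : zmodType) (f : G -> H).
Hypothesis hf : additive_fun f.

Lemma af0 : f 0 = 0.
Proof. by apply: (addrI (f 0)); rewrite -hf !addr0. Qed.
Lemma afN x : f (- x) = - f x.
Proof. by apply: (addrI (f x)); rewrite -hf !subrr af0. Qed.
Lemma afB x y : f (x - y) = f x - f y.
Proof. by rewrite hf afN. Qed.
Lemma af_sum (I : Type) (r : seq I) (P : pred I) (F : I -> G) :
  f (\sum_(i <- r | P i) F i) = \sum_(i <- r | P i) f (F i).
Proof. exact: (big_morph f hf af0). Qed.
Lemma af_sgn b x : f (sgn_odd b x) = sgn_odd b (f x).
Proof. by case: b => //=; exact: afN. Qed.

End AdditiveFun.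

Section SgnOdd.

Variable G : zmodType.

Lemma sgn_odd0 b : sgn_odd b (0 : G) = 0.
Proof. by case: b; rewrite //= oppr0. Qed.
Lemma sgn_oddM b c (x : G) : sgn_odd b (sgn_odd c x) = sgn_odd (b (+) c) x.
Proof. by case: b; case: c; rewrite //= opprK. Qed.
Lemma sgn_oddN b (x : G) : sgn_odd (~~ b) x = - sgn_odd b x.
Proof. by case: b; rewrite //= opprK. Qed.
Lemma sgn_odd_additive b : additive_fun (@sgn_odd G b).
Proof. by move=> x y; case: b; rewrite //= opprD. Qed.

End SgnOdd.

(** * Sections of a locally nilpotent operator *)

Section LocallyNilpotent.

Variables (T : zmodType) (Th : T -> T) (E : nat -> T -> T).
Hypotheses (hTh : additive_fun Th) (hE : forall k, additive_fun (E k)).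
Hypotheses (hE0 : forall x, E 0 x = x)
  (hThE : forall k z, Th z = 0 -> Th (E k.+1 z) = E k z).
Hypothesis nilp : forall x, exists K, iter K Th x = 0.

(* [taylor K] raises the index of each [E k] in the expansion [x = \sum_(k < K) E k z_k] with
   [Th z_k = 0], peeling off the leading coefficient [z_(K-1) = Th^(K-1) x]. *)
Fixpoint taylor (K : nat) (x : T) : T :=
  if K is k.+1 then E k.+1 (iter k Th x) + taylor k (x - E k (iter k Th x)) else 0.

Let iter_additive k : additive_fun (iter k Th).
Proof. by elim: k => [|k IH] x y //=; rewrite IH hTh. Qed.

Lemma taylor_additive K : additive_fun (taylor K).
Proof.
elim: K => [|K IH] x y /=; first by rewrite addr0.
rewrite iter_additive hE -[RHS]addrACA; congr (_ + _); rewrite -IH; congr (taylor K _).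
by rewrite hE opprD addrACA.
Qed.

Lemma iter_E k z : Th z = 0 -> iter k Th (E k z) = z.
Proof. by move=> hz; elim: k => [|k IH]; rewrite ?hE0 // iterSr hThE. Qed.

Lemma iterS_E k z : Th z = 0 -> iter k.+1 Th (E k z) = 0.
Proof. by move=> hz; rewrite iterS iter_E. Qed.

Lemma taylorK K x : iter K Th x = 0 -> Th (taylor K x) = x.
Proof.
elim: K x => [|K IH] x /= hx; first by rewrite (af0 hTh).
have hz : Th (iter K Th x) = 0 by [].
rewrite hTh hThE // IH; first by rewrite addrC subrK.
by rewrite (afB (iter_additive K)) iter_E // subrr.
Qed.

(** The leading coefficients [Th^j x] with [j >= K] are zero, so surplus terms change nothing. *)
Lemma taylor_stable K L x : (K <= L)%N -> iter K Th x = 0 -> taylor L x = taylor K x.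
Proof.
move=> /subnKC <- hx; elim: (L - K)%N => [|j IH]; first by rewrite addn0.
have hj : iter (K + j) Th x = 0.
  by rewrite addnC iterD hx (af0 (iter_additive j)).
by rewrite addnS /= hj !(af0 (hE _)) subr0 add0r.
Qed.

(** [sg] is [taylor] with enough terms for the given element, a common bound serving for several. It
    is built from [Th] and the [E k] alone, hence commutes with every additive [X] that commutes
    with these. *)
Lemma section_exists : exists sg : T -> T,
  [/\ additive_fun sg, forall x, Th (sg x) = x,
      forall k z, Th z = 0 -> sg (E k z) = E k.+1 z
    & forall X : T -> T, additive_fun X -> (forall x, X (Th x) = Th (X x)) ->
        (forall k x, X (E k x) = E k (X x)) -> forall x, X (sg x) = sg (X x)].
Proof.
have nilpb x : exists K, iter K Th x == 0 by have [K hK] := nilp x; exists K; rewrite hK.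
pose sg x := taylor (ex_minn (nilpb x)) x.
have sgE K x : iter K Th x = 0 -> sg x = taylor K x.
  move=> hx; rewrite /sg; case: ex_minnP => n /eqP hn hmin.
  by rewrite -(taylor_stable (L := maxn K n) (leq_maxr _ _) hn) (taylor_stable (leq_maxl _ _)).
have up K L x : (K <= L)%N -> iter K Th x = 0 -> iter L Th x = 0.
  by move=> /subnK <- hx; rewrite iterD hx (af0 (iter_additive _)).
exists sg; split.
- move=> x y; have [K hx] := nilp x; have [L hy] := nilp y.
  have hx' := up _ _ _ (leq_maxl K L) hx; have hy' := up _ _ _ (leq_maxr K L) hy.
  rewrite (sgE _ _ hx') (sgE _ _ hy') (sgE (maxn K L)) ?taylor_additive //.
  by rewrite iter_additive hx' hy' addr0.
- by move=> x; have [K hx] := nilp x; rewrite (sgE _ _ hx) taylorK.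
- move=> k z hz; rewrite (sgE k.+1) /=; last by have := iterS_E k hz.
  by rewrite iter_E // subrr (af0 (taylor_additive k)) addr0.
- move=> X hX hXT hXE x; have [K hx] := nilp x.
  have hXi k y : X (iter k Th y) = iter k Th (X y).
    by elim: k => //= k IH; rewrite hXT IH.
  rewrite (sgE _ _ hx) (sgE K) -?hXi ?hx ?(af0 hX) //.
  elim: (K) (x) => [|k IH] y /=; first exact: af0.
  by rewrite hX IH hXE hXi (afB hX) hXE hXi.
Qed.

End LocallyNilpotent.

(** * Exactness of the Koszul complex in positive degree *)

Section Koszul.

Variables (d : nat) (T : zmodType) (Th : 'I_d -> T -> T).
Hypothesis hTh : forall i, additive_fun (Th i).
Hypothesis hThC : forall i j x, Th i (Th j x) = Th j (Th i x).

Local Notation cnt S i := (#|[set k in S | (k < i)%N]|).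

Let cntD1 (S : {set 'I_d}) (i j : 'I_d) : j \in S ->
  odd (cnt S i) = (j < i)%N (+) odd (cnt (S :\ j) i).
Proof.
move=> hj; rewrite (cardsD1 j) oddD inE hj /=; congr (_ (+) odd _).
  by case: (_ < _)%N.
by apply: eq_card => k; rewrite !inE andbA.
Qed.

Let cntU1 (S : {set 'I_d}) (i j : 'I_d) : j \notin S ->
  odd (cnt (j |: S) i) = (j < i)%N (+) odd (cnt S i).
Proof. by move=> hj; rewrite (@cntD1 (j |: S) i j (setU11 j S)) setU1K. Qed.

Lemma dthetaD w e S : dtheta Th (fun S => w S + e S) S = dtheta Th w S + dtheta Th e S.
Proof.
rewrite /dtheta -big_split; apply: eq_bigr => i _ /=.
by rewrite hTh sgn_odd_additive.
Qed.

Lemma dthetaN w S : dtheta Th (fun S => - w S) S = - dtheta Th w S.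
Proof.
rewrite /dtheta -sumrN; apply: eq_bigr => i _.
by rewrite (afN (hTh i)) (afN (sgn_odd_additive _)).
Qed.

(** Removing [i] then [j], or [j] then [i], gives equal values by [hThC] and opposite signs. *)
Lemma dthetaK w S : dtheta Th (dtheta Th w) S = 0.
Proof.
pose a (i j : 'I_d) :=
  sgn_odd (odd (cnt S i) (+) odd (cnt (S :\ i) j)) (Th i (Th j (w (S :\ i :\ j)))).
have -> : dtheta Th (dtheta Th w) S = \sum_(i in S) \sum_(j in S | j != i) a i j.
  apply: eq_bigr => i _; rewrite (af_sum (hTh i)) (af_sum (sgn_odd_additive _)).
  apply: eq_big => [j|j _]; first by rewrite !inE andbC.
  by rewrite (af_sgn (hTh i)) sgn_oddM.
have -> : \sum_(i in S) \sum_(j in S | j != i) a i j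
  = \sum_(i in S) \sum_(j in S | (j < i)%N) a i j + \sum_(i in S) \sum_(j in S | (i < j)%N) a i j.
  rewrite -big_split; apply: eq_bigr => i _ /=.
  rewrite (bigID (fun j : 'I_d => (j < i)%N)) /=; congr (_ + _); apply: eq_bigl => j.
    by rewrite -andbA; congr (_ && _); rewrite neq_ltn; case: ltngtP.
  by rewrite -andbA; congr (_ && _); rewrite -val_eqE /=; case: ltngtP.
rewrite [X in _ + X](exchange_big_dep (fun j => j \in S)) /=; last by move=> i j _ /andP[].
rewrite -big_split big1 // => i hi /=.
have -> : \sum_(j in S | (i \in S) && (j < i)%N) a j i = \sum_(j in S | (j < i)%N) a j i.
  by apply: eq_bigl => j; rewrite hi.
rewrite -big_split big1 // => j /andP[hj hji] /=.
rewrite /a [S :\ i :\ j]setDDl setUC -setDDl hThC.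
rewrite (cntD1 i hj) (cntD1 j hi) hji ltnNge (ltnW hji) /= addbC.
by rewrite addbN sgn_oddN addNr.
Qed.

Variable sg : 'I_d -> T -> T.
Hypothesis hsg : forall i, additive_fun (sg i).
Hypothesis hsgK : forall i x, Th i (sg i x) = x.
Hypothesis hsgC : forall i j x, i != j -> Th j (sg i x) = sg i (Th j x).

(** Contraction of [w] along the [i]-th coordinate, followed by [sg i]. *)
Definition hsection (i : 'I_d) (w : {set 'I_d} -> T) (S : {set 'I_d}) : T :=
  if i \in S then 0 else sgn_odd (odd (cnt S i)) (sg i (w (i |: S))).

(** If [i] is in [S], only the summand [i] survives and [Th i] undoes [sg i]. Otherwise the cocycle
    condition at [i |: S] expresses [Th i (w S)] through the other summands, whose [Th j] commute
    with [sg i]. *)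
Lemma dtheta_hsection i w : (forall S, dtheta Th w S = 0) -> forall S,
  dtheta Th (hsection i w) S = if i \in S then w S else sg i (Th i (w S)).
Proof.
move=> hw S; case: ifP => hi.
  rewrite /dtheta (bigD1 i) //= big1 ?addr0 => [|j /andP[hj hji]].
    rewrite /hsection !inE eqxx /= setD1K // (af_sgn (hTh i)) hsgK sgn_oddM.
    by rewrite (cntD1 i hi) ltnn addFb addbb.
  by rewrite /hsection !inE eq_sym hji hi (af0 (hTh j)) sgn_odd0.
have := hw (i |: S); rewrite /dtheta big_setU1 ?hi //= setU1K ?hi // cntU1 ?hi // ltnn addFb.
move/(congr1 (fun x => sgn_odd (odd (cnt S i)) (sg i x))).
rewrite (af0 (hsg i)) sgn_odd0 hsg sgn_odd_additive (af_sgn (hsg i)) sgn_oddM addbb /=.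
move/eqP; rewrite addr_eq0 => /eqP ->.
rewrite (af_sum (hsg i)) (af_sum (sgn_odd_additive _)) -sumrN.
apply: eq_bigr => j hj.
have hji : j != i by apply: contraFneq hi => <-.
rewrite /hsection !inE eq_sym (negbTE hji) hi /= (af_sgn (hTh j)) hsgC 1?eq_sym //.
rewrite (af_sgn (hsg i)) !sgn_oddM cntU1 ?hi //.
have -> : i |: S :\ j = (i |: S) :\ j.
  by apply/setP => k; rewrite !inE; case: eqP => // ->; rewrite eq_sym (negbTE hji).
rewrite -sgn_oddN (cntD1 i hj); congr (sgn_odd _ _).
by move: hji; rewrite -val_eqE /=; case: ltngtP => //= _ _; do 2 case: odd.
Qed.

Lemma dtheta_degree k e : (0 < k)%N -> of_degree k.-1 e -> of_degree k (dtheta Th e).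
Proof.
move=> k0 he S hS; rewrite /dtheta big1 // => i hi.
rewrite he ?(af0 (hTh i)) ?sgn_odd0 //.
by apply: contra hS; rewrite (cardsD1 i S) hi => /eqP ->; rewrite add1n prednK.
Qed.

(** Induction over the coordinates: the remainder [w'] is zero on sets containing an index below
    [n], and [hsection] at [n] clears those containing [n] without disturbing the former. The empty
    set is harmless since [k > 0]. *)
Lemma koszul_exact k w : (0 < k)%N -> of_degree k w -> (forall S, dtheta Th w S = 0) ->
  exists e, of_degree k.-1 e /\ forall S, dtheta Th e S = w S.
Proof.
move=> k0 hk hw.
have main n : exists e, of_degree k.-1 e /\
    forall (S : {set 'I_d}) (i : 'I_d), i \in S -> (i < n)%N -> dtheta Th e S = w S.
  elim: n => [|n [e [he heq]]]; first by exists (fun=> 0); split.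
  case: (ltnP n d) => hn; last first.
    by exists e; split=> // S i hi _; apply: (heq S i) => //; apply: leq_trans hn.
  pose i0 := Ordinal hn; pose w' S := w S - dtheta Th e S.
  have hw' S : dtheta Th w' S = 0.
    by rewrite dthetaD hw dthetaN dthetaK subr0.
  have hk' : of_degree k w'.
    by move=> S hS; rewrite /w' hk // (dtheta_degree k0 he) // subr0.
  exists (fun S => e S + hsection i0 w' S); split.
    move=> S hS; rewrite he // add0r /hsection; case: ifP => // hi.
    rewrite hk' ?(af0 (hsg i0)) ?sgn_odd0 //.
    by apply: contra hS; rewrite cardsU1 hi add1n => /eqP <-.
  move=> S i hi hin; rewrite dthetaD dtheta_hsection //.
  case: (ltnP i n) => hin'.
    by rewrite /w' (heq S i) // subrr (af0 (hTh i0)) (af0 (hsg i0)) if_same addr0.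
  have -> : i0 = i by apply: val_inj => /=; lia.
  by rewrite hi /w' addrC subrK.
have [e [he heq]] := main d; exists e; split=> // S.
case: (set_0Vmem S) => [->|[i hi]]; last exact: (heq S i).
by rewrite /dtheta big_set0 hk // cards0 eq_sym -lt0n.
Qed.

End Koszul.

(** * The tensor product *)

Section TensorSpan.

Variables (R : comPzRingType) (M : lmodType R) (S : comPzRingType) (rho : R -> S).
Variables (T : zmodType) (b : M -> S -> T).
Hypothesis hT : is_tensor rho b.

Lemma tensDl m m' x : b (m + m') x = b m x + b m' x.
Proof. by case: hT => [[]]. Qed.
Lemma tensDr m x x' : b m (x + x') = b m x + b m x'.
Proof. by case: hT => [[]]. Qed.
Lemma tensZ r m x : b (r *: m) x = b m (rho r * x).
Proof. by case: hT => [[]]. Qed.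
Lemma tens0l x : b 0 x = 0.
Proof. by apply: (addrI (b 0 x)); rewrite -tensDl !addr0. Qed.
Lemma tens0r m : b m 0 = 0.
Proof. by apply: (addrI (b m 0)); rewrite -tensDr !addr0. Qed.
Lemma tensNl m x : b (- m) x = - b m x.
Proof. by apply: (addrI (b m x)); rewrite -tensDl !subrr tens0l. Qed.

(** Made boolean by excluded middle, so that the spanned subgroup becomes a [zmodType] to which the
    universal property applies. *)
Definition tens_span : {pred T} := fun u : T =>
  if excluded_middle_informative
    (exists s : seq (M * S), u = \sum_(z <- s) b z.1 z.2) then true else false.

Lemma tens_spanP u :
  reflect (exists s : seq (M * S), u = \sum_(z <- s) b z.1 z.2) (u \in tens_span).
Proof.
by rewrite unfold_in; case: excluded_middle_informative => h; constructor.
Qed.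

Fact tens_span_zmod_closed : zmod_closed tens_span.
Proof.
split; first by apply/tens_spanP; exists [::]; rewrite big_nil.
move=> x y /tens_spanP [s ->] /tens_spanP [s' ->]; apply/tens_spanP.
exists (s ++ [seq (- z.1, z.2) | z <- s']); rewrite big_cat big_map /= -sumrN; congr (_ + _).
by apply: eq_bigr => z _; rewrite tensNl.
Qed.

HB.instance Definition _ := GRing.isZmodClosed.Build T tens_span tens_span_zmod_closed.

Record tens_sub := TensSub { tens_val : T; tens_valP : tens_val \in tens_span }.
HB.instance Definition _ := [isSub for tens_val].
HB.instance Definition _ := [Choice of tens_sub by <:].
HB.instance Definition _ := [SubChoice_isSubZmodule of tens_sub by <:].

(* The corestriction of [b] to the subgroup spanned by pure tensors extends to [T], and the
   uniqueness clause identifies its composition with the inclusion with the identity. *)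
Lemma tens_gen u : exists s : seq (M * S), u = \sum_(z <- s) b z.1 z.2.
Proof.
apply/tens_spanP.
have hb m x : b m x \in tens_span.
  by apply/tens_spanP; exists [:: (m, x)]; rewrite big_seq1.
pose g m x : tens_sub := TensSub (hb m x).
have [bal univ] := hT.
have hg : balanced rho g.
  by split=> *; apply: val_inj; rewrite ?raddfD /= ?tensDl ?tensDr ?tensZ.
have [h [hD hgb _]] := univ _ _ hg.
have [h1 [_ _ uniq]] := univ _ _ bal.
have e1 : val (h u) = h1 u.
  apply: (uniq (fun u => val (h u))) => [x y|m x]; first by rewrite hD raddfD.
  by rewrite hgb.
have e2 : u = h1 u by apply: (uniq id).
by rewrite e2 -e1; exact: valP.
Qed.

Lemma tens_ind (P : T -> Prop) : P 0 -> (forall u v, P u -> P v -> P (u + v)) ->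
  (forall m x, P (b m x)) -> forall u, P u.
Proof.
by move=> h0 hD hb u; have [s ->] := tens_gen u; apply: (big_ind P) => // z _; exact: hb.
Qed.

(** Action of [S] on the second factor; multiplication by the [e k] will serve as the operators
    [E k]. *)
Lemma tens_mul : exists mul : S -> T -> T, forall f,
  additive_fun (mul f) /\ forall m x, mul f (b m x) = b m (f * x).
Proof.
have [bal univ] := hT.
have H f : exists h : T -> T, additive_fun h /\ forall m x, h (b m x) = b m (f * x).
  have [|h [h1 h2 _]] := univ _ (fun m x => b m (f * x)); last by exists h.
  by split=> *; rewrite ?tensDl ?mulrDr ?tensDr ?tensZ // mulrCA.
exists (fun f => proj1_sig (constructive_indefinite_description _ (H f))) => f.
by case: constructive_indefinite_description.
Qed.

End TensorSpan.

Section TensorIdeal.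

Variables (p : nat) (R : comPzRingType) (M : lmodType R) (S : comPzRingType).
Variables (rho : {rmorphism R -> S}) (T : zmodType) (b : M -> S -> T) (q : R).
Hypothesis hT : is_tensor rho b.

(** The factors [p] and [u] move one at a time across the tensor sign, until a generator of [I^N]
    acts on [m]. *)
Lemma tens_ipow0 N m x :
  (forall j, (j <= N)%N -> (p%:R ^+ j * qnum p q ^+ (N - j)) *: m = 0) ->
  ipow p (rho (qnum p q)) (fun=> True) N x -> b m x = 0.
Proof.
elim: N m x => [|N IH] m x hm.
  by have := hm 0%N isT; rewrite subn0 !expr0 mul1r scale1r => -> _; apply: (tens0l hT).
move=> [y [z [hy hz ->]]].
rewrite (tensDr hT) -(rmorph_nat rho) -!(tensZ hT) (IH _ y) ?(IH _ z) ?addr0 //.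
- move=> j hj; rewrite scalerA -(hm j) ?(leq_trans hj) //; congr (_ *: _).
  by rewrite subSn // exprS; ring.
- move=> j hj; rewrite scalerA -(hm j.+1) //; congr (_ *: _).
  by rewrite subSS exprS; ring.
Qed.

End TensorIdeal.

(** * The operators [Th i] on the tensor product *)

Section TensorComplex.

Variables (p : nat) (hp : prime p) (d : nat) (R : comPzRingType) (dR : R -> R) (q : R).
Hypotheses (hR : delta_ring p dR) (hq : dR q = 0).
Variables (S : comPzRingType) (dS : S -> S) (rho : {rmorphism R -> S}).
Hypotheses (hS : delta_ring p dS) (hrho : delta_map dR dS rho).
Variables (t tau : 'I_d -> S) (a : 'I_d -> R).
Hypotheses (htau : forall i, rho (qnum p q) * tau i = t i - rho (a i))
  (ht : forall i, dS (t i) = 0).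
Variables (theta : 'I_d -> S -> S).
Hypothesis hder : forall i, alpha_derivation rho (t i * rho (q - 1)) (theta i).
Hypothesis hcomp : forall i, delta_compatible p dS (t i * rho (q - 1))
  (t i ^+ p.-1 * rho (qeta p q)) (theta i).
Hypothesis htheta : forall i j, theta i (tau j) = if i == j then 1 else 0.
Variable N : nat.
Hypothesis hspan : forall x, exists (K : nat) (c : {ffun 'I_d -> 'I_K} -> R),
  ipow p (rho (qnum p q)) (fun=> True) N
    (x - \sum_(m : {ffun 'I_d -> 'I_K})
           rho (c m) * \prod_(i < d) delta_pow p dS (tau i) (m i)).
Variables (M : lmodType R) (T : zmodType) (b : M -> S -> T).
Hypothesis hM : forall (m : M) j, (j <= N)%N ->
  (p%:R ^+ j * qnum p q ^+ (N - j)) *: m = 0.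
Hypothesis hT : is_tensor rho b.
Variable Th : 'I_d -> T -> T.
Hypothesis hTh : forall i, additive_fun (Th i) /\ forall m x, Th i (b m x) = b m (theta i x).

Local Notation gens i := (dgens dS rho (t i) (tau i)).

Let ThD i : additive_fun (Th i). Proof. by case: (hTh i). Qed.
Let Thb i m x : Th i (b m x) = b m (theta i x). Proof. by case: (hTh i). Qed.
Let thD i y z : theta i (y + z) = theta i y + theta i z. Proof. by case: (hder i). Qed.
Let thr i r y : theta i (rho r * y) = rho r * theta i y. Proof. by case: (hder i). Qed.
Let th1 i : theta i 1 = 0. Proof. by case: (hder i). Qed.
Let thM i y z : theta i (y * z) =
  theta i y * z + y * theta i z + t i * rho (q - 1) * theta i y * theta i z.
Proof. by case: (hder i). Qed.

Let b0 m x : ipow p (rho (qnum p q)) (fun=> True) N x -> b m x = 0.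
Proof. by apply: (tens_ipow0 hT) => j; exact: hM. Qed.

Lemma gens_theta i y : gens i y -> gens i (theta i y).
Proof.
apply: (dgens_theta hp hS hrho (htau i) (ht i) (hder i) (hcomp i)).
by rewrite htheta eqxx.
Qed.

Lemma theta_gens i j y : i != j -> gens j y -> theta i y = 0.
Proof.
move=> hij; apply: (dgens_ann hp hS (htau j) (hder i) (hcomp i)).
by rewrite htheta (negbTE hij).
Qed.

Let theta_mul_const i y c : theta i c = 0 -> theta i (y * c) = theta i y * c.
Proof. by move=> hc; rewrite thM hc !mulr0 !addr0. Qed.

Lemma theta_prod0 i (P : pred 'I_d) (y : 'I_d -> S) :
  (forall l, P l -> theta i (y l) = 0) -> theta i (\prod_(l | P l) y l) = 0.
Proof.
move=> h; apply: (big_ind (fun x => theta i x = 0)) => // x z hx hz.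
by rewrite theta_mul_const // hx mul0r.
Qed.

(* Sums of pure tensors in the constants for the first [n] operators. *)
Inductive gspan (n : nat) : T -> Prop :=
| gspan0 : gspan n 0
| gspanD m y v : (forall l, gens l (y l)) -> gspan n v ->
    gspan n (b m (\prod_(l < d | (n <= l)%N) y l) + v).

Lemma gspan_add n u v : gspan n u -> gspan n v -> gspan n (u + v).
Proof.
move=> hu hv; elim: hu => [|m y w hy _ IH]; first by rewrite add0r.
by rewrite -addrA; apply: gspanD.
Qed.

Lemma gspan1 n m y : (forall l, gens l (y l)) -> gspan n (b m (\prod_(l < d | (n <= l)%N) y l)).
Proof. by move=> hy; rewrite -[b _ _]addr0; apply: gspanD => //; exact: gspan0. Qed.

(** By [hspan], [x] is a combination of monomials up to an error in [I^N]; the error dies because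
    [I^N] kills [M], and the coefficients move onto [m]. *)
Lemma gspan_full u : gspan 0 u.
Proof.
move: u; apply: (tens_ind hT); [exact: gspan0 | exact: gspan_add |].
move=> m x; have [K [c hc]] := hspan x.
set s := \sum_(k : _) _ in hc; rewrite -(subrK s x) (tensDr hT) b0 // add0r /s.
apply: (big_ind (fun x => gspan 0 (b m x))).
- by rewrite (tens0r hT); exact: gspan0.
- by move=> y z hy hz; rewrite (tensDr hT); exact: gspan_add.
- move=> k _; rewrite -(tensZ hT); apply: (@gspan1 0) => l; exact: dgens_delta_pow.
Qed.

Lemma gen_ind (P : T -> Prop) : P 0 -> (forall u v, P u -> P v -> P (u + v)) ->
  (forall m y, (forall l, gens l (y l)) -> P (b m (\prod_(l < d) y l))) -> forall u, P u.
Proof.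
move=> h0 hD hP u; elim: (gspan_full u) => // m y v hy _ hv.
by apply: (hD) => //; exact: hP.
Qed.

(** With [Y] the product of the other factors, both composites give [theta_i(y i) theta_j(y j) Y]:
    [theta_j(y j)] stays in [D_j], where [theta_i] vanishes, and symmetrically. *)
Lemma Th_comm i j u : Th i (Th j u) = Th j (Th i u).
Proof.
have [->//|hij] := eqVneq i j.
move: u; apply: gen_ind; first by rewrite !(af0 (ThD _)).
  by move=> u v hu hv; rewrite !ThD hu hv.
move=> m y hy; rewrite !Thb; congr (b m _).
have prodE : \prod_(l < d) y l = y i * y j * \prod_(l < d | (l != i) && (l != j)) y l.
  by rewrite (bigD1 i) //= (bigD1 j) 1?eq_sym //= mulrA.
have c0 k : (k == i) || (k == j) -> theta k (\prod_(l < d | (l != i) && (l != j)) y l) = 0.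
  move=> hk; apply: theta_prod0 => l /andP[hi hj]; apply: (theta_gens _ (hy l)).
  by case/orP: hk => /eqP ->; rewrite eq_sym.
set Y := \prod_(l < d | (l != i) && (l != j)) y l in prodE c0.
have hci : theta i Y = 0 by apply: c0; rewrite eqxx.
have hcj : theta j Y = 0 by apply: c0; rewrite eqxx orbT.
have hij' := theta_gens hij (hy j).
have hji : theta j (y i) = 0 by apply: (theta_gens _ (hy i)); rewrite eq_sym.
have e1 : theta j (\prod_(l < d) y l) = y i * (theta j (y j) * Y).
  rewrite prodE theta_mul_const // [y i * y j]mulrC theta_mul_const //.
  by rewrite mulrAC mulrC.
have e2 : theta i (\prod_(l < d) y l) = y j * (theta i (y i) * Y).
  by rewrite prodE theta_mul_const // theta_mul_const // mulrAC mulrC.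
have kj : theta i (theta j (y j) * Y) = 0.
  by rewrite theta_mul_const // (theta_gens hij (gens_theta (hy j))) mul0r.
have ki : theta j (theta i (y i) * Y) = 0.
  by rewrite theta_mul_const // (theta_gens _ (gens_theta (hy i))) ?mul0r // eq_sym.
by rewrite e1 e2 (theta_mul_const (y i) kj) (theta_mul_const (y j) ki); ring.
Qed.

Section FixMul.

Variable mul : S -> T -> T.
Hypothesis hmul : forall f, additive_fun (mul f) /\ forall m x, mul f (b m x) = b m (f * x).

Let mulA f : additive_fun (mul f). Proof. by case: (hmul f). Qed.
Let mulb f m x : mul f (b m x) = b m (f * x). Proof. by case: (hmul f). Qed.

Let mul1 u : mul 1 u = u.
Proof.
move: u; apply: (tens_ind hT) => [|u v hu hv|m x]; [exact: af0 | by rewrite mulA hu hv |].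
by rewrite mulb mul1r.
Qed.

Let mulDl f g u : mul (f + g) u = mul f u + mul g u.
Proof.
move: u; apply: (tens_ind hT) => [|u v hu hv|m x].
- by rewrite !(af0 (mulA _)) addr0.
- by rewrite !mulA hu hv addrACA.
- by rewrite !mulb mulrDl (tensDr hT).
Qed.

Let mul_I f u : ipow p (rho (qnum p q)) (fun=> True) N f -> mul f u = 0.
Proof.
move=> hf; move: u; apply: (tens_ind hT) => [|u v hu hv|m x].
- exact: af0.
- by rewrite mulA hu hv addr0.
- by rewrite mulb b0 //; apply: ipowMr.
Qed.

Let mul0 u : mul 0 u = 0.
Proof. by apply: mul_I; apply: ipow0. Qed.

Let Th_mul i f u : Th i (mul f u) =
  mul (theta i f) u + mul f (Th i u) + mul (t i * rho (q - 1) * theta i f) (Th i u).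
Proof.
move: u; apply: (tens_ind hT) => [|u v hu hv|m x].
- by rewrite !(af0 (mulA _), af0 (ThD _)) !addr0.
- by rewrite !(mulA, ThD) hu hv addrACA; congr (_ + _); rewrite addrACA.
- by rewrite !(mulb, Thb) thM !(tensDr hT).
Qed.

Let b_prod_split (P : pred 'I_d) i m y : P i -> b m (\prod_(l < d | P l) y l) =
   b m (y i * \prod_(l < d | P l && (l != i)) y l).
Proof. by move=> hi; rewrite (bigD1 i). Qed.

Lemma Th_const i (P : pred 'I_d) m y : (forall l, gens l (y l)) ->
  Th i (b m (\prod_(l < d | P l && (l != i)) y l)) = 0.
Proof.
move=> hy; rewrite Thb theta_prod0 ?(tens0r hT) // => l /andP[_ hl].
by apply: theta_gens (hy l); rewrite eq_sym.
Qed.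

(** [section_exists] with [E k] multiplication by [e k]. On [e k * c] with [c] killed by [Th i], the
    operator [id - sg Th] is zero for [k > 0] and the identity for [k = 0], where no factor from
    [D_i] is left; hence the last clause. *)
Lemma Th_section i : exists sg : T -> T,
  [/\ additive_fun sg, forall x, Th i (sg x) = x,
      forall j x, i != j -> Th j (sg x) = sg (Th j x)
    & forall u, gspan i u -> gspan i.+1 (u - sg (Th i u))].
Proof.
have htt : theta i (tau i) = 1 by rewrite htheta eqxx.
have [e [e0 ge he espan]] :=
  theta_basis hp hR hq hS hrho (htau i) (ht i) (hder i) (hcomp i) htt N.
have isub n y : ipow p (rho (qnum p q)) (gens i) n y ->
    ipow p (rho (qnum p q)) (fun=> True) n y by apply: ipow_mono.
have hE0 x : mul (e 0%N) x = x by rewrite e0 mul1.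
have hThE k z : Th i z = 0 -> Th i (mul (e k.+1) z) = mul (e k) z.
  move=> hz; rewrite Th_mul hz !(af0 (mulA _)) !addr0.
  by rewrite -(subrK (e k) (theta i _)) mulDl mul_I ?add0r //; exact: isub (he k).
(* A factor [y] in [D_i] may be replaced by a combination of the [e k]: the error in [I^N] is
   killed, and the coefficients move onto the module element. *)
have expand m y c (P : T -> Prop) : gens i y -> P 0 -> (forall u v, P u -> P v -> P (u + v)) ->
    (forall k m, P (mul (e k) (b m c))) -> P (b m (y * c)).
  move=> hy h0 hD hP; have [z [hz hI]] := espan _ hy.
  rewrite -(subrK z y) mulrDl (tensDr hT) b0 ?add0r; last first.
    by apply: ipowMr => //; exact: isub.
  elim: hz => [|r k z' _ IH]; first by rewrite mul0r (tens0r hT).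
  rewrite mulrDl (tensDr hT); apply: (hD) => //.
  by rewrite -mulrA -(tensZ hT) -mulb.
have nilp x : exists K, iter K (Th i) x = 0.
  have itD k : additive_fun (iter k (Th i)).
    by elim: k => [|k IH] u v //=; rewrite IH ThD.
  have nilpD u v : (exists K, iter K (Th i) u = 0) -> (exists K, iter K (Th i) v = 0) ->
      exists K, iter K (Th i) (u + v) = 0.
    move=> [K hK] [L hL]; exists (K + L)%N.
    by rewrite itD {1}addnC !iterD hK hL !(af0 (itD _)) addr0.
  move: x; apply: gen_ind.
  - by exists 0%N.
  - exact: nilpD.
  - move=> m y hy; rewrite (b_prod_split (P := predT) (i := i)) //.
    have hc m' := @Th_const i predT m' y hy.
    apply: (expand m (y i) _ (fun x => exists K, iter K (Th i) x = 0)) => //.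
    + by exists 0%N.
    + by move=> k m'; exists k.+1; apply: (iterS_E hE0 hThE).
have [sg [sgD sgK sgE sgX]] := section_exists (ThD i) (fun k => mulA (e k)) hE0 hThE nilp.
exists sg; split=> // [j x hij|u].
  (* [Th j] commutes with multiplication by [e k], because [theta j] kills [D_i]. *)
  apply: sgX => [|y|k y]; [exact: ThD | exact: Th_comm |].
  by rewrite Th_mul (theta_gens _ (ge k)) 1?eq_sym // mulr0 !mul0 add0r addr0.
elim=> {u} [|m y v hy _ IH].
  by rewrite (af0 (ThD i)) (af0 sgD) subr0; exact: gspan0.
rewrite (ThD i) sgD opprD addrACA; apply: gspan_add => //.
rewrite (b_prod_split (P := fun l : 'I_d => (i <= l)%N) (i := i)) //.
have hc m' := @Th_const i (fun l : 'I_d => (i <= l)%N) m' y hy.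
apply: (expand m (y i) _ (fun x => gspan i.+1 (x - sg (Th i x)))) => //.
- by rewrite (af0 (ThD i)) (af0 sgD) subr0; exact: gspan0.
- by move=> u w hu hw; rewrite (ThD i) sgD opprD addrACA; exact: gspan_add.
move=> [|k] m'; last by rewrite hThE // sgE // subrr; exact: gspan0.
rewrite hE0 hc (af0 sgD) subr0.
rewrite (_ : \prod_(l < d | _) _ = \prod_(l < d | (i.+1 <= l)%N) y l); first exact: gspan1.
by apply: eq_bigl => l; rewrite -val_eqE /=; case: ltngtP.
Qed.

End FixMul.

Lemma Th_sections : exists sg : 'I_d -> T -> T,
  [/\ forall i, additive_fun (sg i), forall i x, Th i (sg i x) = x,
      forall i j x, i != j -> Th j (sg i x) = sg i (Th j x)
    & forall (i : 'I_d) u, gspan i u -> gspan i.+1 (u - sg i (Th i u))].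
Proof.
have [mul hmul] := tens_mul hT.
exists (fun i => proj1_sig (constructive_indefinite_description _ (Th_section hmul i))).
split=> i *; case: constructive_indefinite_description => sg [/= ? ? ? h] //; auto.
Qed.

(** Each step from [n] to [n+1] strips one factor by [Th_sections]; at [n = d] the product is
    empty. *)
Lemma Th_kernel u : (forall i, Th i u = 0) -> exists m, u = b m 1.
Proof.
move=> hu; have [sg [sgD _ _ hsg]] := Th_sections.
have main n : (n <= d)%N -> gspan n u.
  elim: n => [|n IH] hn; first exact: gspan_full.
  have := hsg (Ordinal hn) u (IH (ltnW hn)).
  by rewrite hu (af0 (sgD _)) subr0.
elim: (main d (leqnn d)) => [|m y v _ _ [m' ->]]; first by exists 0; rewrite (tens0l hT).
exists (m + m'); rewrite (tensDl hT) big_pred0 // => l.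
by rewrite leqNgt ltn_ord.
Qed.

End TensorComplex.

(** * The completion and the coefficient of 1 *)

Lemma ipow_monomial p (S : comPzRingType) (u : S) N j : (j <= N)%N ->
  ipow p u (fun=> True) N (p%:R ^+ j * u ^+ (N - j)).
Proof.
move=> /subnKC {1}<-; move: (N - j)%N => k; elim: j => [|j IH].
  rewrite expr0 mul1r add0n; elim: k => [|k IH] //.
  by rewrite exprS; apply: (ipow_uM (@psubT S)).
by rewrite addSn exprS -mulrA; apply: (ipow_pM (@psubT S)).
Qed.

Lemma rmorph_qnum p (R S : comPzRingType) (f : {rmorphism R -> S}) q :
  f (qnum p q) = qnum p (f q).
Proof. by rewrite rmorph_sum; apply: eq_bigr => i _; rewrite rmorphXn. Qed.

Section Completion.

Variables (p : nat) (D Dh : comPzRingType) (qD : D).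
Variables (iota : {rmorphism D -> Dh}) (phi : nat -> Dh -> D).
Hypothesis hDh : is_Icompletion p qD iota phi.

Let u := qnum p qD.
Local Notation I n x := (ipow p u (fun=> True) n x).
Let hP := @psubT D.

Lemma phiD n x y : I n (phi n (x + y) - (phi n x + phi n y)).
Proof. by apply/powI_ipow; case: hDh => [[]]. Qed.
Let phiM n x y : I n (phi n (x * y) - phi n x * phi n y).
Proof. by apply/powI_ipow; case: hDh => [[]]. Qed.
Lemma phi1 n : I n (phi n 1 - 1).
Proof. by apply/powI_ipow; case: hDh => [[]]. Qed.
Let phiS n x : I n (phi n.+1 x - phi n x).
Proof. by apply/powI_ipow; case: hDh => [[]]. Qed.
Let phi_iota n y : I n (phi n (iota y) - y).
Proof. by apply/powI_ipow; case: hDh => _ []. Qed.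
Let phi_sep x : (forall n, I n (phi n x)) -> x = 0.
Proof. by move=> h; case: hDh => _ [_ + _]; apply=> n; apply/powI_ipow. Qed.
Let phi_lim (y : nat -> D) : (forall n, I n (y n.+1 - y n)) ->
  exists x, forall n, I n (phi n x - y n).
Proof.
move=> h; case: hDh => _ [_ _ /(_ y) [n|x hx]]; first exact/powI_ipow.
by exists x => n; apply/powI_ipow.
Qed.

Lemma phi_scale n y x : I n (phi n (iota y * x) - y * phi n x).
Proof.
have -> : phi n (iota y * x) - y * phi n x = phi n (iota y * x) - phi n (iota y) * phi n x
   + phi n x * (phi n (iota y) - y) by ring.
by apply: ipowD => //; apply: ipowMl.
Qed.

Lemma phi_subM n x y z : I n (phi n (x - iota y * z) - (phi n x - y * phi n z)).
Proof.
have -> : phi n (x - iota y * z) - (phi n x - y * phi n z)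
  = phi n (x + iota (- y) * z) - (phi n x + phi n (iota (- y) * z))
    + (phi n (iota (- y) * z) - (- y) * phi n z) by rewrite rmorphN mulNr; ring.
by apply: ipowD => //; [exact: phiD | exact: phi_scale].
Qed.

Let phi_le m n x : (m <= n)%N -> I m (phi n x - phi m x).
Proof.
move=> /subnKC <-; elim: (n - m)%N => [|k IH]; first by rewrite addn0 subrr; exact: ipow0.
have -> : phi (m + k.+1) x - phi m x
  = phi (m + k).+1 x - phi (m + k) x + (phi (m + k) x - phi m x) by rewrite addnS; ring.
by apply: ipowD => //; apply: (ipow_le hP _ (leq_addr k m)).
Qed.

(* As [I] is finitely generated, an element of the completion that vanishes in [D / I^N D] is a
   convergent combination of the generators of [I^N]. *)
Lemma completion_ipow N z : I N (phi N z) -> ipow p (iota u) (fun=> True) N z.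
Proof.
elim: N z => [|N IH] z //; move=> [a [a' [ha ha' ez]]].
have /all_sig2 : forall k, {y : D * D | I (N + k) y.1 /\ I (N + k) y.2
    & phi (N.+1 + k).+1 z - phi (N.+1 + k) z = p%:R * y.1 + u * y.2}.
  move=> k; have : exists y : D * D, (I (N + k) y.1 /\ I (N + k) y.2)
    /\ phi (N.+1 + k).+1 z - phi (N.+1 + k) z = p%:R * y.1 + u * y.2.
    have [y [y' [hy hy' e]]] := phiS (N.+1 + k) z.
    by exists (y, y').
  by move=> /constructive_indefinite_description [y []]; exists y.
move=> [Y hY eY].
have lim (c : D) (f : nat -> D) : I N c -> (forall k, I (N + k) (f k)) ->
    exists L, I N (phi N L) /\ forall m, I m (phi m L - (c + \sum_(k < m) f k)).
  move=> hc hf; have [|L hL] := @phi_lim (fun m => c + \sum_(k < m) f k).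
    move=> m; rewrite big_ord_recr /=; set s := \sum_(k < m) f k.
    have -> : c + (s + f m) - (c + s) = f m by ring.
    exact: (ipow_le hP _ (leq_addl N m)).
  exists L; split=> //; rewrite -(subrK (c + \sum_(k < N) f k) (phi N L)).
  apply: ipowD => //; apply: ipowD => //; apply: ipow_sum => // k _.
  by apply: (ipow_le hP _ (leq_addr k N)).
have [L [hL eL]] := lim a _ ha (fun k => proj1 (hY k)).
have [L' [hL' eL']] := lim a' _ ha' (fun k => proj2 (hY k)).
exists L, L'; split; [exact: IH | exact: IH |].
apply/eqP; rewrite -subr_eq0 opprD addrA -(rmorph_nat iota); apply/eqP.
apply: phi_sep => m.
move: (eL m) (eL' m) => {}eL {}eL'.
set s := a + _ in eL; set s' := a' + _ in eL'.
have sumE : phi (N.+1 + m) z = p%:R * s + u * s'.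
  rewrite /s /s'; elim: m {s s' eL eL'} => [|m IHm].
    by rewrite addn0 !big_ord0 !addr0.
  have := eY m; rewrite addnS => /eqP; rewrite subr_eq => /eqP ->.
  by rewrite IHm !big_ord_recr /=; ring.
set z1 := z - iota p%:R * L.
have -> : phi m (z1 - iota u * L') = (phi m (z1 - iota u * L') - (phi m z1 - u * phi m L'))
  + (phi m z1 - (phi m z - p%:R * phi m L))
  - (phi (N.+1 + m) z - phi m z)
  - p%:R * (phi m L - s) - u * (phi m L' - s') by rewrite sumE; ring.
apply: ipowB => //; last by apply: ipowMl => //; exact: eL'.
apply: ipowB => //; last by apply: ipowMl => //; exact: eL.
apply: ipowB => //; last by apply: phi_le; exact: leq_addl.
by apply: ipowD => //; exact: phi_subM.
Qed.

End Completion.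

(** * The coefficient of 1 modulo [I^N] *)

Section ConstantCoefficient.

Variables (p d : nat) (R D : comPzRingType) (q : R) (f : {rmorphism R -> D}).
Variable mon : 'I_d -> nat -> D.
Hypothesis mon0 : forall i, mon i 0 = 1.
Variable N : nat.

Local Notation I x := (ipow p (f (qnum p q)) (fun=> True) N x).
Local Notation lc K c :=
  (\sum_(m : {ffun 'I_d -> 'I_K}) f (c m) * \prod_(i < d) mon i (m i)).

Hypothesis mon_span : forall x, exists K (c : {ffun 'I_d -> 'I_K} -> R), I (x - lc K c).
Hypothesis mon_free : forall K (c : {ffun 'I_d -> 'I_K} -> R), I (lc K c) ->
  forall m, ipow p (qnum p q) (fun=> True) N (c m).

Let hP := @psubT D.

Let widen K K' (hK : (K <= K')%N) (m : {ffun 'I_d -> 'I_K}) : {ffun 'I_d -> 'I_K'} :=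
  [ffun i => widen_ord hK (m i)].

Lemma lc_widen K K' (hK : (K <= K')%N) (c : {ffun 'I_d -> 'I_K} -> R) :
  exists c' : {ffun 'I_d -> 'I_K'} -> R,
    lc K' c' = lc K c /\ forall m, c' (widen hK m) = c m.
Proof.
have inj : injective (widen hK).
  move=> m m' /ffunP h; apply/ffunP => i; apply: val_inj.
  by have := congr1 val (h i); rewrite !ffunE.
pose c' m' := if [pick m | widen hK m == m'] is Some m then c m else 0.
have c'E m : c' (widen hK m) = c m.
  by rewrite /c'; case: pickP => [m' /eqP /inj ->|/(_ m)] //; rewrite eqxx.
exists c'; split=> //.
rewrite (bigID (fun m' => m' \in widen hK @: setT)) /= [X in _ + X]big1 ?addr0.
  rewrite big_imset /=; last by move=> m m' _ _; exact: inj.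
  apply: eq_big => [m|m _]; first by rewrite inE.
  by rewrite c'E; congr (_ * _); apply: eq_bigr => i _; rewrite ffunE.
move=> m' hm'; rewrite /c'; case: pickP => [m /eqP e|_]; last by rewrite rmorph0 mul0r.
by rewrite -e imset_f in hm'.
Qed.

(** A relation, as the coefficient is determined only modulo [I^N]; the bound [K.+1] makes the zero
    exponent available as an index. *)
Definition const_coef (x : D) (r : R) : Prop :=
  exists K (c : {ffun 'I_d -> 'I_K.+1} -> R),
    ipow p (f (qnum p q)) (fun=> True) N
      (x - \sum_(m : {ffun 'I_d -> 'I_K.+1}) f (c m) * \prod_(i < d) mon i (m i))
    /\ c [ffun=> ord0] = r.

Lemma const_coef_exists x : exists r, const_coef x r.
Proof.
have [K [c hc]] := mon_span x; have [c' [e _]] := lc_widen (leqnSn K) c.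
by exists (c' [ffun=> ord0]), K, c'; rewrite e.
Qed.

Lemma const_coef_widen x r K : const_coef x r -> exists K', (K <= K')%N /\
  exists c : {ffun 'I_d -> 'I_K'.+1} -> R, I (x - lc K'.+1 c) /\ c [ffun=> ord0] = r.
Proof.
move=> [L [c [hc hr]]]; exists (maxn K L); split; first exact: leq_maxl.
have hK : (L.+1 <= (maxn K L).+1)%N by rewrite ltnS leq_maxr.
have [c' [e h]] := lc_widen hK c; exists c'; rewrite e; split=> //.
rewrite -hr -h; congr (c' _); apply/ffunP => i; rewrite !ffunE; exact: val_inj.
Qed.

Lemma const_coefD x x' r r' : const_coef x r -> const_coef x' r' ->
  const_coef (x + x') (r + r').
Proof.
move=> h h'; have [L [_ [c0 [hc0 hr0]]]] := const_coef_widen 0 h.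
have [K [hK [c' [hc' hr']]]] := const_coef_widen L h'.
have [c [e hc]] := lc_widen (hK : (L.+1 <= K.+1)%N) c0.
exists K, (fun m => c m + c' m); split; last first.
  rewrite hr' -hr0 -hc; congr (c _ + _); apply/ffunP => i; rewrite !ffunE; exact: val_inj.
under eq_bigr => m _ do rewrite rmorphD mulrDl.
by rewrite big_split /= opprD addrACA; apply: ipowD => //; rewrite e.
Qed.

Lemma const_coefM s x r : const_coef x r -> const_coef (f s * x) (s * r).
Proof.
move=> [K [c [hc <-]]]; exists K, (fun m => s * c m); split=> //.
under eq_bigr => m _ do rewrite rmorphM -mulrA.
by rewrite -mulr_sumr -mulrBr; apply: ipowMl.
Qed.

(** The difference of two expansions expands an element of [I^N], so freeness puts its coefficients
    in [I^N]. *)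
Lemma const_coef_uniq x x' r r' : I (x - x') -> const_coef x r -> const_coef x' r' ->
  ipow p (qnum p q) (fun=> True) N (r - r').
Proof.
move=> hx h h'; have := const_coefD h (const_coefM (-1) h').
rewrite rmorphN1 !mulN1r => -[K [c [hc <-]]].
apply: mon_free; rewrite -(subKr (x - x') (lc _ _)).
by apply: ipowB.
Qed.

Lemma const_coef1 : const_coef 1 1.
Proof.
exists 0%N, (fun=> 1); split=> //.
rewrite (bigD1 [ffun=> ord0]) //= [X in _ - (_ + X)]big1 => [|m].
  rewrite rmorph1 mul1r addr0 big1 ?subrr; first exact: ipow0.
  by move=> i _; rewrite ffunE mon0.
by case/eqP; apply/ffunP => i; rewrite ffunE; exact: ord1.
Qed.

End ConstantCoefficient.

(** * Exactness of the complex *)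

Set Strict Implicit.
Unset Implicit Arguments.

Theorem theorem7p6
  (p : nat) (hp : prime p) (d : nat)
  (* R: a delta-Z[q]-algebra *)
  (R : comPzRingType) (dR : R -> R) (q : R)
  (hR : delta_ring p dR) (hq : dR q = 0)
  (* A: a delta-R-algebra *)
  (A : comPzRingType) (dA : A -> A) (fRA : {rmorphism R -> A})
  (hA : delta_ring p dA) (hfRA : delta_map dR dA fRA)
  (* T_i = t_i - a_i, delta(t_i) = 0 *)
  (T t : 'I_d -> A) (a : 'I_d -> R)
  (hT : forall i, T i = t i - fRA (a i)) (ht : forall i, dA (t i) = 0)
  (* D: the delta-envelope of A[S]/([p]_q S_i - T_i), tau_i image of S_i *)
  (D : comPzRingType) (dD : D -> D) (fAD : {rmorphism A -> D}) (tau : 'I_d -> D)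
  (hD : is_delta_envelope p dA (fRA (qnum p q)) T dD fAD tau)
  (* freeness of D/I^{n+1}D over R/I^{n+1} with basis prod_i tau_i^{m_i}_delta *)
  (hfree : forall n : nat,
     (forall x : D, exists (N : nat) (c : {ffun 'I_d -> 'I_N} -> R),
        powI p (fAD (fRA q)) n.+1
          (x - \sum_(m : {ffun 'I_d -> 'I_N})
                 fAD (fRA (c m)) * \prod_(i < d) delta_pow p dD (tau i) (m i)))
     /\ (forall (N : nat) (c : {ffun 'I_d -> 'I_N} -> R),
        powI p (fAD (fRA q)) n.+1
          (\sum_(m : {ffun 'I_d -> 'I_N})
                 fAD (fRA (c m)) * \prod_(i < d) delta_pow p dD (tau i) (m i)) ->
        forall m, powI p q n.+1 (c m)))
  (* Dh: the I-adic completion of D, with the completed delta-structure *)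
  (Dh : comPzRingType) (iota : {rmorphism D -> Dh}) (phi : nat -> Dh -> D)
  (hDh : is_Icompletion p (fAD (fRA q)) iota phi)
  (dh : Dh -> Dh) (hdh : completed_delta p (fAD (fRA q)) dD iota phi dh)
  (* theta_i: t_i mu-derivations, delta-compatible w.r.t. t_i^{p-1} eta *)
  (theta : 'I_d -> Dh -> Dh)
  (hder : forall i, alpha_derivation (fun r => iota (fAD (fRA r)))
                      (iota (fAD (t i * fRA (q - 1)))) (theta i))
  (hcomp : forall i, delta_compatible p dh
                      (iota (fAD (t i * fRA (q - 1))))
                      (iota (fAD (t i ^+ p.-1 * fRA (qeta p q)))) (theta i))
  (htau : forall i j, theta i (iota (tau j)) = if i == j then 1 else 0)
  (* J an ideal of R containing a power of I, M an R/J-module *)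
  (J : R -> Prop)
  (hJ0 : J 0) (hJD : forall x y, J x -> J y -> J (x + y))
  (hJM : forall r x, J x -> J (r * x))
  (hJI : exists N, forall x, powI p q N x -> J x)
  (M : lmodType R) (hM : forall r (m : M), J r -> r *: m = 0)
  (* (Tn, b) = M (x)_R Dh, and Th_i = id_M (x) theta_i *)
  (Tn : zmodType) (b : M -> Dh -> Tn)
  (hTn : is_tensor (fun r => iota (fAD (fRA r))) b)
  (Th : 'I_d -> Tn -> Tn)
  (hTh : forall i, additive_fun (Th i) /\ forall m x, Th i (b m x) = b m (theta i x)) :
  let eps := fun m : M => b m 1 in
  [/\ (* complex *)
      (forall w S, dtheta Th (dtheta Th w) S = 0),
      (forall m S, dtheta Th (@deg0 d Tn (eps m)) S = 0),
      (* exact at M and in degree 0 *)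
      (forall m m', eps m = eps m' -> m = m'),
      (forall w, of_degree 0 w -> (forall S, dtheta Th w S = 0) ->
         exists m, w set0 = eps m)
    & (* exact in degrees >= 1 *)
      (forall (k : nat) w, (0 < k)%N -> of_degree k w ->
         (forall S, dtheta Th w S = 0) ->
         exists e, of_degree k.-1 e /\ forall S, dtheta Th e S = w S)].
Proof.
pose rho : {rmorphism R -> Dh} := iota \o fAD \o fRA : {rmorphism R -> Dh}.
pose th i : Dh := iota (fAD (t i)).
pose tauh i := iota (tau i).
have [hD1 hD2 hD3 _] := hD.
have [hdh1 hdh2 _] := hdh.
(* The freeness hypothesis concerns exponents [n+1]; passing from [N0] to [N0 + 1] is harmless since
   [I^(N0+1)] is contained in [I^N0]. *)
have [N0 hN0] := hJI; pose N := N0.+1.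
have hu : qnum p (fAD (fRA q)) = fAD (fRA (qnum p q)) by rewrite !rmorph_qnum.
have hrho : delta_map dR dh rho.
  by move=> r; rewrite /rho /= -hdh2 -hD2 -hfRA.
have htauh i : rho (qnum p q) * tauh i = th i - rho (a i).
  by rewrite /rho /th /tauh /= -rmorphM hD3 hT !rmorphB.
have hth i : dh (th i) = 0 by rewrite /th -hdh2 -hD2 ht !rmorph0.
have hder' i : alpha_derivation rho (th i * rho (q - 1)) (theta i).
  by have := hder i; rewrite !rmorphM.
have hcomp' i : delta_compatible p dh (th i * rho (q - 1))
    (th i ^+ p.-1 * rho (qeta p q)) (theta i).
  by have := hcomp i; rewrite !rmorphM !rmorphXn.
have iter_iota i j : iota (iter j dD (tau i)) = iter j dh (tauh i).
  by elim: j => //= j IH; rewrite hdh2 IH.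
have hspan x : exists (K : nat) (c : {ffun 'I_d -> 'I_K} -> R),
  ipow p (rho (qnum p q)) (fun=> True) N
    (x - \sum_(m : {ffun 'I_d -> 'I_K})
           rho (c m) * \prod_(i < d) delta_pow p dh (tauh i) (m i)).
  have [/(_ (phi N x)) [K [c /powI_ipow hc]] _] := hfree N0.
  exists K, c; have -> : rho (qnum p q) = iota (qnum p (fAD (fRA q))) by rewrite hu.
  apply: (completion_ipow hDh).
  set s := \sum_(m : _) _ in hc.
  (* The factor 1 gives the shape of [phi_subM]; [phi N 1] is then replaced by 1 modulo [I^N]. *)
  have -> : \sum_(m : {ffun 'I_d -> 'I_K})
           rho (c m) * \prod_(i < d) delta_pow p dh (tauh i) (m i) = iota s * 1.
    rewrite mulr1 rmorph_sum; apply: eq_bigr => m _; rewrite rmorphM rmorph_prod.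
    congr (_ * _); apply: eq_bigr => i _; rewrite rmorph_prod; apply: eq_bigr => j _.
    by rewrite rmorphXn iter_iota.
  have := phi_subM hDh N x s 1.
  set e := phi N _ => he.
  have -> : e = (e - (phi N x - s * phi N 1)) + (phi N x - s) - s * (phi N 1 - 1) by ring.
  apply: ipowB => //; first by apply: ipowD.
  by apply: ipowMl => //; exact: (phi1 hDh).
have killN (r : R) (m : M) : ipow p (qnum p q) (fun=> True) N r -> r *: m = 0.
  move=> h; apply: hM; apply: hN0; apply/powI_ipow.
  exact: (ipowS (@psubT R) _ h).
have hM' (m : M) j : (j <= N)%N -> (p%:R ^+ j * qnum p q ^+ (N - j)) *: m = 0.
  by move=> hj; apply: killN; exact: ipow_monomial.
have hTn' : is_tensor rho b := hTn.
have ThC := Th_comm hp hdh1 hrho htauh hth hder' hcomp' htau hspan hM' hTn' hTh.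
have [sg [sgD sgK sgC _]] :=
  Th_sections hp hR hq hdh1 hrho htauh hth hder' hcomp' htau hspan hM' hTn' hTh.
have ker := Th_kernel hp hR hq hdh1 hrho htauh hth hder' hcomp' htau hspan hM' hTn' hTh.
have ThD i : additive_fun (Th i) by case: (hTh i).
have theta1 i : theta i 1 = 0 by case: (hder i).
have Thb1 i m : Th i (b m 1) = 0.
  by case: (hTh i) => _ ->; rewrite theta1 (tens0r hTn').
split.
- exact: (dthetaK ThD ThC).
- move=> m S; rewrite /dtheta big1 // => i _; rewrite /deg0.
  by case: eqP => _; rewrite ?Thb1 ?(af0 (ThD i)) sgn_odd0.
- have mon0 i : delta_pow p dD (tau i) 0 = 1 by rewrite tp0.
  pose f : {rmorphism R -> D} := fAD \o fRA : {rmorphism R -> D}.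
  pose mon i k := delta_pow p dD (tau i) k.
  have mspan x : exists K (c : {ffun 'I_d -> 'I_K} -> R),
      ipow p (f (qnum p q)) (fun=> True) N
        (x - \sum_(m : {ffun 'I_d -> 'I_K}) f (c m) * \prod_(i < d) mon i (m i)).
    have [/(_ x) [K [c /powI_ipow hc]] _] := hfree N0.
    by exists K, c; rewrite /f /= -hu.
  have mfree K (c : {ffun 'I_d -> 'I_K} -> R) : ipow p (f (qnum p q)) (fun=> True) N
        (\sum_(m : {ffun 'I_d -> 'I_K}) f (c m) * \prod_(i < d) mon i (m i)) ->
      forall m, ipow p (qnum p q) (fun=> True) N (c m).
    move=> h m; apply/powI_ipow; have [_ /(_ K c)] := hfree N0; apply.
    by apply/powI_ipow; rewrite hu.
  (* [lam] chooses a constant coefficient of [phi N x]. Its ambiguity lies in [I^N], which kills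
     [M], so sending [m (x) x] to [lam x *: m] is balanced and induces a retraction of [eps]. *)
  have [lam hlam] : exists lam : Dh -> R, forall x, const_coef p q f mon N (phi N x) (lam x).
    exists (fun x => epsilon (inhabits 0) (const_coef p q f mon N (phi N x))) => x.
    by apply: epsilon_spec; exact: (const_coef_exists mspan).
  have phiDN x y := phiD hDh N x y; have phi1N := phi1 hDh N.
  have phiZN y x := phi_scale hDh N y x.
  rewrite hu in phiDN phi1N phiZN.
  have lamE x y r (m : M) : ipow p (f (qnum p q)) (fun=> True) N (phi N x - y) ->
      const_coef p q f mon N y r -> lam x *: m = r *: m.
    move=> h hc; apply/eqP; rewrite -subr_eq0 -scalerBl; apply/eqP; apply: killN.
    exact: (const_coef_uniq mfree h (hlam x) hc).
  have bal : balanced rho (fun (m : M) x => lam x *: m).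
    split=> [m m' x|m x x'|r m x].
    + exact: scalerDr.
    + by rewrite -scalerDl; apply: (lamE _ _ _ _ (phiDN x x')); exact: const_coefD.
    + rewrite scalerA mulrC; apply/esym; apply: (lamE _ _ _ _ (phiZN _ _)).
      exact: const_coefM.
  have [_ /(_ _ _ bal) [h [_ hb _]]] := hTn'.
  have lam1 (m : M) : lam 1 *: m = m.
    by rewrite -[RHS]scale1r; apply: (lamE _ _ _ _ phi1N); exact: const_coef1.
  move=> m m' e; rewrite -(lam1 m) -(lam1 m') -!hb; congr (h _); exact: e.
- move=> w hw hcl; apply: ker => i.
  (* The differential at [[set i]] is [Th i (w set0)], with positive sign because no element of the
     singleton lies below [i]. *)
  have := hcl [set i]; rewrite /dtheta big_set1 setDv.
  have -> : [set j in [set i] | (j < i)%N] = set0.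
    by apply/setP => j; rewrite !inE; case: eqP => // ->; rewrite ltnn.
  by rewrite cards0.
- move=> k w; exact: (koszul_exact ThD ThC sgD sgK sgC).
Qed.
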